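(* Let $S_{\rm N}=S_o\cup\bigcup_{i\in J}(S_i\cap C_i)$ be the nested tessellation in which the first-layer tessellation $S_o$ is a Manhattan grid satisfying $\mathbb{E}[\exp(\alpha|S_o\cap B_1|)]<\infty$ for all $\alpha\in\mathbb{R}$, with cells $(C_i)_{i\in J}$, and in which the second-layer tessellations $S_i$, $i\in J$, are Manhattan grids, each based on two independent homogeneous Poisson processes on $\mathbb{R}$. Then $\mathbb{E}[\exp(\alpha|S_{\rm N}\cap B_1|)]<\infty$ for all $\alpha\in\mathbb{R}$.
   Context: $B_1\subset\mathbb{R}^2$ is the closed unit disk centered at the origin. For a tessellation $S$ and measurable $A\subset\mathbb{R}^2$, $|S\cap A|=\nu_1(S\cap A)$ is the total edge length in $A$, $\nu_1$ being one-dimensional Hausdorff measure. Manhattan grid: for $Y=(Y_{\rm v},Y_{\rm h})$, where $Y_{\rm v}=\{Y_{i,\rm v}\}_{i\in I_{\rm v}}$ and $Y_{\rm h}=\{Y_{i,\rm h}\}_{i\in I_{\rm h}}$ are two independent simple stationary point processes on $\mathbb{R}$, $$S_{\rm M}(Y)=\bigcup_{i\in I_{\rm h}}(\mathbb{R}\times\{Y_{i,\rm h}\})\ \cup\ \bigcup_{j\in I_{\rm v}}(\{Y_{j,\rm v}\}\times\mathbb{R}).$$ Cells: a cell of a tessellation $S$ is a nonempty connected open set $C\subset\mathbb{R}^2$ with $C\cap S=\emptyset$ and $\partial C\subset S$; $(C_i)_{i\in J}$ is the collection of cells of $S_o$. Nested tessellation: the second-layer tessellations $S_i$, $i\in J$,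 are identically distributed, independent of each other and of $S_o$. Here $S_i=S_{\rm M}(Y^{(i)}_{\rm v},Y^{(i)}_{\rm h})$, where $Y^{(i)}_{\rm v}$ and $Y^{(i)}_{\rm h}$ are independent homogeneous Poisson processes on $\mathbb{R}$ with intensities $\lambda_{\rm v}>0$ and $\lambda_{\rm h}>0$ not depending on $i$. *)

(* Defs.v *)
From HB Require Import structures.
From mathcomp Require Import all_boot all_order all_algebra finmap.
From mathcomp Require Import all_classical all_reals all_analysis measurable_realfun.

Set Implicit Arguments.
Unset Strict Implicit.
Unset Printing Implicit Defensive.

Import Order.TTheory GRing.Theory Num.Theory.
Import numFieldNormedType.Exports.

Local Open Scope classical_set_scope.
Local Open Scope ring_scope.
Local Open Scope ereal_scope.

(* One-dimensional Hausdorff measure is taken for the Euclidean metric; the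
   canonical norm of R * R is the sup norm, hence the explicit distance. *)
Definition edist (R : realType) (p q : R * R) : R :=
  Num.sqrt ((p.1 - q.1) ^+ 2 + (p.2 - q.2) ^+ 2)%R.

(* The element 0 gives the empty set diameter 0 instead of -oo. *)
Definition diam (R : realType) (A : set (R * R)) : \bar R :=
  ereal_sup (0 |` [set (edist p q)%:E | p in A & q in A]).

Definition hausdorff1_delta (R : realType) (delta : R) (A : set (R * R)) :
    \bar R :=
  ereal_inf [set \sum_(0 <= n <oo) diam (U n) |
    U in [set U : (set (R * R))^nat |
            A `<=` \bigcup_n U n /\ forall n, diam (U n) <= delta%:E]].

Definition hausdorff1 (R : realType) (A : set (R * R)) : \bar R :=
  ereal_sup [set hausdorff1_delta delta A |
    delta in [set delta : R | (0 < delta)%R]].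

Definition unit_disk (R : realType) : set (R * R) :=
  [set p | (p.1 ^+ 2 + p.2 ^+ 2 <= 1)%R].
Arguments unit_disk {R}.

Definition manhattan (R : realType) (Yv Yh : set R) : set (R * R) :=
  (\bigcup_(y in Yh) [set p | p.2 = y]) `|`
  (\bigcup_(y in Yv) [set p | p.1 = y]).

Definition is_cell (R : realType) (S C : set (R * R)) : Prop :=
  [/\ C !=set0, connected C, open C, C `&` S = set0
    & closure C `\` interior C `<=` S].

(* An injective numbering of all the cells by a (finite or infinite) set J of
   natural numbers; C is irrelevant outside J. *)
Definition cell_labelling (R : realType) (S : set (R * R))
    (J : set nat) (C : nat -> set (R * R)) : Prop :=
  set_bij J [set D | is_cell S D] C.

Definition nested (R : realType) (So : set (R * R)) (J : set nat)
    (C S : nat -> set (R * R)) : set (R * R) :=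
  So `|` \bigcup_(i in J) (S i `&` C i).

Definition sigma_of d d' (T : measurableType d) (U : measurableType d')
    (X : T -> U) : set (set T) :=
  preimage_set_system setT X measurable.

Definition independent2 d (T : measurableType d) (R : realType)
    (P : probability T R) (F G : set (set T)) : Prop :=
  forall A B, F A -> G B -> P (A `&` B) = P A * P B.

Definition mutually_independent d (T : measurableType d) (R : realType)
    (P : probability T R) (I : choiceType) (F : I -> set (set T)) : Prop :=
  forall (s : {fset I}) (A : I -> set T),
    (forall i, i \in s -> F i (A i)) ->
    P (\bigcap_(i in [set` s]) A i) = \prod_(i <- s) P (A i).

(* A simple configuration is identified with its set of points; the
   sigma-algebra is the one generated by the counts of points in Borel sets. *)
Definition count_events (R : realType) : set (set (set R)) :=
  [set E | exists2 B : set R, measurable B &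
     exists2 A : set (\bar R), measurable A &
       E = [set Y : set R | A (counting (Y `&` B))]].

Definition config (R : realType) := g_sigma_algebraType (@count_events R).

Definition simple_point_process d (T : measurableType d) (R : realType)
    (Y : T -> config R) : Prop :=
  measurable_fun setT Y /\
  forall w (a b : R), finite_set ((Y w : set R) `&` `[a, b]).

Definition stationary d (T : measurableType d) (R : realType)
    (P : probability T R) (Y : T -> config R) : Prop :=
  forall (x : R) (E : set (config R)), measurable E ->
    P [set w | E ([set (x + y)%R | y in (Y w : set R)] : config R)]
    = P [set w | E (Y w)].

(* The probabilities are written out because the library's [poisson_pmf] is
   identically 1 at rate 0, which occurs here for Lebesgue-null sets. *)
Definition poisson_process d (T : measurableType d) (R : realType)
    (P : probability T R) (lambda : R) (Y : T -> config R) : Prop :=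
  [/\ simple_point_process Y,
      forall (B : set R) (k : nat), measurable B ->
        lebesgue_measure B < +oo ->
        P [set w | counting ((Y w : set R) `&` B) = k%:R%:E :> \bar R]
        = (let m := lambda * fine (lebesgue_measure B) in
           m ^+ k / k`!%:R * expR (- m))%R%:E
    & forall B : (set R)^nat, (forall n, measurable (B n)) ->
        trivIset setT B ->
        mutually_independent P (fun n =>
          sigma_of (fun w => counting ((Y w : set R) `&` B n) : \bar R))].

(* Main.v *)
Require Import Defs.
From HB Require Import structures.
From mathcomp Require Import all_boot all_order all_algebra finmap.
From mathcomp Require Import all_classical all_reals all_analysis measurable_realfun.
From mathcomp Require Import ring lra.

(** Write [S_N] for the nested tessellation and let [a > 0].  Inside a cell [C_i]
    the second layer has length
      sum over the points [y] of [Y_v^(i)] of |{t : (y, t) in C_i}|, plus the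
    same sum for the horizontal lines.  Given the first layer the cells are
    fixed, and the exponential moment of such a Poisson sum is [exp] of a
    quantity bounded by a constant times the area of [C_i] inside a fixed box.
    The cells are pairwise disjoint, so these areas add up to at most the area
    of the box and the product over all cells of the conditional exponential
    moments is bounded by a constant [K] that does not depend on the first
    layer.  Hence [E exp(a |S_N|) <= K * E exp(a |S_o|)].

    The areas are handled by a Riemann sum.  The square with sides [-1, 2[ is cut
    into [(n+1)^2] small ones; a small square counts for the cell that contains its lower
    left corner, which is an event of the first layer, and each corner lies in
    at most one cell.  As the cells are open, the true length is at most the
    lower limit of the grid lengths ([hausdorff1_nested_le]), and Fatou's lemma
    reduces the claim to a bound that is uniform in [n].  For fixed [n] the
    assignment of the squares to the first [n] cells takes finitely many values;
    on each of them independence factorizes the expectation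
    ([conditional_product_le]), and a direct computation with Poisson counts
    bounds the factors ([poisson_length_exp_le]).

    The integral of a nonnegative function that is not known to be measurable is
    a supremum over simple functions below it, hence still monotone
    ([le_integral_of_le]).  The lengths are therefore only compared with
    measurable quantities.  For the first layer this is the number of points in
    [-1, 1]: it dominates the length up to the factor 2
    ([hausdorff1_manhattan_disk_le]), while the number of points in [-1/2, 1/2]
    is at most twice the length ([cnt_le_hausdorff1_manhattan]); stationarity
    carries the exponential moments from the short interval to the long one
    ([first_layer_exp_moments]). *)

Set Implicit Arguments.
Unset Strict Implicit.
Unset Printing Implicit Defensive.

Import Order.TTheory GRing.Theory Num.Theory.
Import numFieldNormedType.Exports.

Local Open Scope classical_set_scope.
Local Open Scope ring_scope.
Local Open Scope ereal_scope.

(** * Integrals and independence *)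

Import HBNNSimple.

(** Both integrals are suprema over the simple functions below the integrand,
    whether or not the integrand is measurable. *)
Lemma le_integral_of_le d (T : measurableType d) (R : realType)
    (mu : {measure set T -> \bar R}) (f g : T -> \bar R) :
  (forall x, 0 <= f x) -> (forall x, f x <= g x) ->
  \int[mu]_x f x <= \int[mu]_x g x.
Proof.
move=> f0 fg; have g0 x : 0 <= g x by exact: le_trans (fg x).
rewrite !ge0_integralTE//; apply: ereal_sup_le => _ [h hf <-].
by exists h => // x; apply: le_trans (fg x); exact: hf.
Qed.

(** The case [q = +oo] is where monotonicity is needed: the products are then
    constantly [0] or eventually [+oo]. *)
Lemma cvg_mule_nd (R : realType) (u : (\bar R)^nat) (l q : \bar R) :
  (forall n, 0 <= u n) -> {homo u : m n / (m <= n)%N >-> m <= n} ->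
  u n @[n --> \oo] --> l -> 0 <= q -> u n * q @[n --> \oo] --> l * q.
Proof.
move=> u0 ndu ul q0.
have [qfin|] := boolP (q \is a fin_num); first exact: cvgeZr.
rewrite ge0_fin_numE// -leNgt leye_eq => /eqP ->.
have le_l n : u n <= l.
  rewrite (cvg_unique _ ul (ereal_nondecreasing_cvgn ndu))//.
  by apply: ereal_sup_ubound; exists n.
have [l0|l0] := eqVneq l 0.
  have -> : (fun n => u n * +oo) = (fun=> l * +oo); last exact: cvg_cst.
  apply/funext => n; congr (_ * _); apply/eqP; rewrite l0 eq_le u0 andbT.
  by rewrite -l0.
have {}l0 : 0 < l by rewrite lt0e l0 (le_trans (u0 0%N)).
have [N uN] : exists N, 0 < u N.
  apply/not_existsP => H; move: l0; rewrite ltNge => /negP; apply.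
  apply: cvge_le ul; apply: nearW => n; rewrite leNgt; exact/negP.
rewrite gt0_muley//; apply: cvg_near_cst; exists N => // n /= Nn.
by rewrite gt0_muley// (lt_le_trans uN)// ndu.
Qed.

Section independence.
Context d (T : measurableType d) (R : realType) (P : probability T R).

Lemma integral_indic_comp d' (U : measurableType d') (Y : T -> U) (B : set U) :
  measurable_fun setT Y -> measurable B ->
  \int[P]_w (\1_B (Y w))%:E = P (Y @^-1` B).
Proof.
move=> mY mB; rewrite -[RHS]mul1e.
transitivity (\int[P]_w (\1_(Y @^-1` B) w)%:E); first exact: eq_integral.
rewrite integral_indic// ?setIT ?mul1e//.
by rewrite -[X in measurable X]setTI; exact: mY.
Qed.

(** The hypothesis says that the measures [B |-> E[psi; Y in B]] and
    [c P(Y in B)] agree, so that they integrate every [phi] to the same value;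
    simple functions and monotone convergence give the passage from sets to
    functions. *)
Lemma integral_factor d' (U : measurableType d') (Y : T -> U)
    (psi : T -> \bar R) (c : \bar R) :
  measurable_fun setT Y -> measurable_fun setT psi ->
  (forall w, 0 <= psi w) -> 0 <= c -> c \is a fin_num ->
  (forall B, measurable B ->
     \int[P]_w ((\1_B (Y w))%:E * psi w) = P (Y @^-1` B) * c) ->
  forall phi : U -> \bar R, measurable_fun setT phi ->
    (forall u, 0 <= phi u) ->
    \int[P]_w (phi (Y w) * psi w) = (\int[P]_w phi (Y w)) * c.
Proof.
move=> mY mpsi psi0 c0 cfin H phi mphi phi0.
have simple (h : {nnsfun U >-> R}) :
    \int[P]_w ((h (Y w))%:E * psi w) = (\int[P]_w (h (Y w))%:E) * c.
  set s := fset_set (h @` setT).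
  have s0 (i : 'I_#|`s|) : (0 <= s`_i)%R.
    have : s`_i \in s by exact: mem_nth.
    by rewrite in_fset_set// => /set_mem[u _ <-].
  have hE w : (h (Y w))%:E =
      \sum_(i < #|`s|) (s`_i * \1_(h @^-1` [set s`_i]) (Y w))%:E.
    by rewrite fimfunEord -sumEFin.
  have mh r : measurable (h @^-1` [set r]) by exact: measurable_funPTI.
  have mhY r : measurable_fun setT
      (fun w => (\1_(h @^-1` [set r]) (Y w))%:E : \bar R).
    by apply/measurable_EFinP; apply: measurableT_comp => //.
  transitivity (\int[P]_w (\sum_(i < #|`s|)
      ((s`_i)%:E * ((\1_(h @^-1` [set s`_i]) (Y w))%:E * psi w)))).
    apply: eq_integral => w _; rewrite hE ge0_sume_distrl//.
      by apply: eq_bigr => i _; rewrite EFinM muleA.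
    by move=> i _; rewrite lee_fin mulr_ge0.
  rewrite ge0_integral_sum//; last 2 first.
    move=> i; apply: emeasurable_funM => //; exact: emeasurable_funM.
    by move=> i w _; rewrite !mule_ge0// lee_fin.
  under [in RHS]eq_integral do rewrite hE.
  rewrite ge0_integral_sum//; last 2 first.
    move=> i; under eq_fun do rewrite EFinM; exact: emeasurable_funM.
    by move=> i w _; rewrite lee_fin mulr_ge0.
  rewrite ge0_sume_distrl; last first.
    by move=> i _; apply: integral_ge0 => w _; rewrite lee_fin mulr_ge0.
  apply: eq_bigr => i _; rewrite ge0_integralZl_EFin//; last 2 first.
    by move=> w _; rewrite mule_ge0// lee_fin.
    exact: emeasurable_funM.
  rewrite H// muleA; congr (_ * c); rewrite -integral_indic_comp//.
  rewrite -ge0_integralZl_EFin//.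
pose g := nnsfun_approx measurableT mphi.
have gphi u : (g n u)%:E @[n --> \oo] --> phi u.
  by apply: cvg_nnsfun_approx => // x _; exact: phi0.
have ndg u : {homo (fun n => (g n u)%:E) : m n / (m <= n)%N >-> m <= n}.
  by move=> m n mn; rewrite lee_fin; exact/lefP/nd_nnsfun_approx.
have mg n : measurable_fun setT (fun w => (g n (Y w))%:E).
  by apply/measurable_EFinP; apply: measurableT_comp => //; exact: measurable_funP.
have lim_mul (q : T -> \bar R) : measurable_fun setT q ->
    (forall w, 0 <= q w) ->
  \int[P]_w ((g n (Y w))%:E * q w) @[n --> \oo] -->
    \int[P]_w (phi (Y w) * q w).
  move=> mq q0.
  rewrite (_ : (fun w => _) = (fun w => limn (fun n => (g n (Y w))%:E * q w))).
    apply: (@cvg_monotone_convergence _ _ _ P setT measurableT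
      (fun n w => (g n (Y w))%:E * q w)).
    - by move=> n; exact: emeasurable_funM.
    - by move=> n w _; rewrite mule_ge0// lee_fin.
    - by move=> w _ m n mn; rewrite lee_wpmul2r// ndg.
  apply/funext => w; apply/esym/cvg_lim => //.
  apply: (@cvg_mule_nd R (fun n => (g n (Y w))%:E)).
  - by move=> n; rewrite lee_fin.
  - exact: ndg.
  - exact: gphi.
  - exact: q0.
have lim1 : \int[P]_w (g n (Y w))%:E @[n --> \oo] --> \int[P]_w phi (Y w).
  have mul1 (f : T -> \bar R) : \int[P]_w f w = \int[P]_w (f w * 1).
    by apply: eq_integral => w _; rewrite mule1.
  under eq_fun do rewrite mul1; rewrite mul1.
  by apply: (lim_mul (cst 1)) => // w; rewrite lee_fin.
have lim2 : \int[P]_w ((g n (Y w))%:E * psi w) @[n --> \oo] -->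
    \int[P]_w (phi (Y w) * psi w).
  exact: lim_mul.
have simpleE : (fun n => \int[P]_w ((g n (Y w))%:E * psi w)) =
    (fun n => (\int[P]_w (g n (Y w))%:E) * c).
  by apply/funext => n; exact: simple.
by rewrite simpleE in lim2; apply: cvg_unique lim2 _ => //; exact: cvgeZr.
Qed.

(** [integral_factor] is used twice, to replace first one indicator function and
    then the other. *)
Lemma integral_independent2 d' (U V : measurableType d') (X : T -> U)
    (Y : T -> V) (f : U -> \bar R) (g : V -> \bar R) :
  measurable_fun setT X -> measurable_fun setT Y ->
  independent2 P (sigma_of X) (sigma_of Y) ->
  measurable_fun setT f -> (forall u, 0 <= f u) ->
  measurable_fun setT g -> (forall v, 0 <= g v) ->
  \int[P]_w g (Y w) < +oo ->
  \int[P]_w (f (X w) * g (Y w)) = (\int[P]_w f (X w)) * \int[P]_w g (Y w).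
Proof.
move=> mX mY XY mf f0 mg g0 gfin.
apply: integral_factor => //.
- exact: measurableT_comp.
- exact: integral_ge0.
- by rewrite ge0_fin_numE//; exact: integral_ge0.
- move=> B mB; under eq_integral do rewrite muleC.
  have mXB : measurable (X @^-1` B) by rewrite -[X in measurable X]setTI; exact: mX.
  rewrite [RHS]muleC.
  apply: (@integral_factor _ _ Y (fun w => (\1_B (X w))%:E)) => //.
  + by apply/measurable_EFinP; exact: measurableT_comp.
  + exact: (fin_num_measure P).
  move=> A mA; rewrite muleC -XY; last 2 first.
  + by exists B => //; rewrite setTI.
  + by exists A => //; rewrite setTI.
  have mYA : measurable (Y @^-1` A) by rewrite -[X in measurable X]setTI; exact: mY.
  transitivity (\int[P]_w (\1_(X @^-1` B `&` Y @^-1` A) w)%:E).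
    by apply: eq_integral => w _; rewrite indicI EFinM muleC.
  by rewrite integral_indic ?setIT//; exact: measurableI.
Qed.

Section mutual.
Context (I : choiceType) d' (U : measurableType d') (Y : I -> T -> U).
Hypothesis mY : forall i, measurable_fun setT (Y i).
Hypothesis Yind : mutually_independent P (fun i => sigma_of (Y i)).

Let mYB i B : measurable B -> measurable (Y i @^-1` B).
Proof. by move=> mB; rewrite -[X in measurable X]setTI; exact: mY. Qed.

Lemma mutually_independent_seq (s : seq I) (B : I -> set U) : uniq s ->
  (forall i, measurable (B i)) ->
  P (\bigcap_(i in [set` s]) (Y i @^-1` B i)) = \prod_(i <- s) P (Y i @^-1` B i).
Proof.
move=> us mB.
have -> : [set` s] = [set` [fset x in s]%fset].
  by apply/seteqP; split => x /=; rewrite !inE.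
rewrite Yind.
  by apply: perm_big; apply: uniq_perm => // x; rewrite !inE.
by move=> i _; exists (B i) => //; rewrite setTI.
Qed.

(** The product formula for events is turned into the one for functions by
    replacing one indicator function at a time with [integral_factor]. *)
Lemma integral_mutually_independent (phi : I -> U -> \bar R) (s : seq I) :
  (forall i, measurable_fun setT (phi i)) -> (forall i u, 0 <= phi i u) ->
  (forall i, \int[P]_w phi i (Y i w) < +oo) -> uniq s ->
  \int[P]_w (\prod_(i <- s) phi i (Y i w)) = \prod_(i <- s) \int[P]_w phi i (Y i w).
Proof.
move=> mphi phi0 phifin us.
have prod0 (r : seq I) w : 0 <= \prod_(i <- r) phi i (Y i w).
  by apply: prode_ge0.
have mprod (r : seq I) : measurable_fun setT (fun w => \prod_(i <- r) phi i (Y i w)).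
  elim: r => [|i r IH]; first by under eq_fun do rewrite big_nil; exact: measurable_cst.
  under eq_fun do rewrite big_cons; apply: emeasurable_funM => //.
  exact: measurableT_comp.
have int0 i : 0 <= \int[P]_w phi i (Y i w) by exact: integral_ge0.
(* In [gen] the indices in [t] still carry indicator functions, those in [r]
   already carry the functions [phi i]. *)
suff gen (r t : seq I) (B : I -> set U) : uniq (r ++ t) ->
    (forall i, measurable (B i)) ->
    \int[P]_w ((\1_(\bigcap_(i in [set` t]) (Y i @^-1` B i)) w)%:E *
       \prod_(i <- r) phi i (Y i w)) =
    (\prod_(i <- t) P (Y i @^-1` B i)) * \prod_(i <- r) \int[P]_w phi i (Y i w).
  have := gen s [::] (fun=> setT); rewrite cats0 big_nil mul1e.
  move=> /(_ us (fun=> measurableT)) <-; apply: eq_integral => w _.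
  by rewrite set_nil bigcap_set0 indicT mul1e.
have mcap (t' : seq I) (B' : I -> set U) : (forall j, measurable (B' j)) ->
    measurable (\bigcap_(j in [set` t']) (Y j @^-1` B' j)).
  by move=> mB'; apply: fin_bigcap_measurable => // j _; exact: mYB.
elim: r t B => [|i r IH] t B.
  move=> ut mB; rewrite big_nil mule1.
  under eq_integral do rewrite big_nil mule1.
  rewrite integral_indic//; last exact: mcap.
  by rewrite setIT; exact: mutually_independent_seq.
rewrite cat_cons /= => /andP[irt urt] mB.
pose psi w := (\1_(\bigcap_(j in [set` t]) (Y j @^-1` B j)) w)%:E *
  \prod_(j <- r) phi j (Y j w).
transitivity (\int[P]_w (phi i (Y i w) * psi w)).
  by apply: eq_integral => w _; rewrite big_cons /psi !muleA (muleC (phi i _)).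
rewrite (@integral_factor _ _ (Y i) psi
  ((\prod_(j <- t) P (Y j @^-1` B j)) * \prod_(j <- r) \int[P]_w phi j (Y j w)))//.
- by rewrite big_cons muleCA.
- apply: emeasurable_funM => //; apply/measurable_EFinP.
  by apply: measurable_indic; exact: mcap.
- by move=> w; rewrite mule_ge0// lee_fin.
- by rewrite mule_ge0// prode_ge0.
- rewrite fin_numM// prode_fin_num// => j _.
    exact: (fin_num_measure P) (mYB j (mB j)).
  by rewrite ge0_fin_numE.
move=> A mA.
have it : i \notin t by move: irt; rewrite mem_cat negb_or => /andP[].
have Bt j : j \in t -> (if j == i then A else B j) = B j.
  by case: eqP => // -> jt; rewrite jt in it.
have uirt : uniq (r ++ i :: t).
  by rewrite -cat1s uniq_catCA /= irt.
have mB' j : measurable (if j == i then A else B j) by case: ifP.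
have := IH (i :: t) _ uirt mB'; rewrite big_cons eqxx -muleA.
rewrite (eq_big_seq (fun j => P (Y j @^-1` B j))); last by move=> j /Bt ->.
move=> <-; apply: eq_integral => w _; rewrite /psi muleA -EFinM; congr (_%:E * _).
have -> : [set` i :: t] = i |` [set` t].
  apply/seteqP; split => j /=; rewrite in_cons.
    by case/predU1P => [->|jt]; [left|right].
  by case=> [->|jt]; apply/orP; [left|right].
rewrite bigcap_setU1 eqxx indicI; congr (_ * \1_ _ _)%R.
by apply: eq_bigcapr => j /= /Bt ->.
Qed.
End mutual.

End independence.
(** * Exponential moments of counts *)

Section counts.
Context (R : realType).

(** An infinite count is given the default value [0]; [B] is bounded and [Y]
    locally finite wherever the value matters. *)
Definition cnt (B : set R) (Y : config R) : R :=
  fine (counting ((Y : set R) `&` B) : \bar R).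

Lemma counting_ge0 (T : choiceType) (A : set T) : 0 <= (counting A : \bar R).
Proof. by rewrite /counting; case: ifP => // _; rewrite lee_fin. Qed.

Lemma cnt_ge0 B Y : (0 <= cnt B Y)%R.
Proof. by apply: fine_ge0; exact: counting_ge0. Qed.

Lemma measurable_counting_in (B : set R) : measurable B ->
  measurable_fun setT
    (fun Y : config R => counting ((Y : set R) `&` B) : \bar R).
Proof.
move=> mB _ A mA; rewrite setTI; apply: sub_sigma_algebra.
by exists B => //; exists A.
Qed.

Lemma measurable_cnt (B : set R) : measurable B -> measurable_fun setT (cnt B).
Proof.
move=> mB; apply: (@measurableT_comp _ _ _ _ _ _ (@fine R)).
  exact: fine_measurable.
exact: measurable_counting_in.
Qed.

Lemma counting_cnt B (Y : config R) : finite_set ((Y : set R) `&` B) ->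
  counting ((Y : set R) `&` B) = (cnt B Y)%:E.
Proof. by move=> fYB; rewrite /cnt /counting asboolT. Qed.

Lemma cntE B (Y : config R) : finite_set ((Y : set R) `&` B) ->
  cnt B Y = #|` fset_set ((Y : set R) `&` B)|%:R.
Proof. by move=> fYB; rewrite /cnt /counting asboolT. Qed.

Lemma counting_inj_image (T U : choiceType) (f : T -> U) (A : set T) :
  injective f -> finite_set A -> counting (f @` A) = counting A :> \bar R.
Proof.
move=> finj fA; rewrite /counting !asboolT//; last exact: finite_image.
by rewrite fset_set_image// card_imfset.
Qed.

Section process.
Context d (T : measurableType d) (P : probability T R) (Y : T -> config R).
Hypothesis Ypp : simple_point_process Y.

Lemma finite_point_process w (B : set R) (a b : R) : B `<=` `[a, b] ->
  finite_set ((Y w : set R) `&` B).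
Proof. by move=> Bab; apply: sub_finite_set (Ypp.2 w a b); exact: setIS. Qed.

Lemma measurable_cnt_process (B : set R) : measurable B ->
  measurable_fun setT (fun w => cnt B (Y w)).
Proof. by move=> mB; apply: measurableT_comp (measurable_cnt mB) Ypp.1. Qed.

(** The exponential moment depends on the law of the count only, which is how
    both stationarity and the Poisson law enter. *)
Lemma integral_expR_cnt (B : set R) (a b s : R) :
  measurable B -> B `<=` `[a, b] ->
  \int[P]_w (expR (s * cnt B (Y w)))%:E =
  \sum_(0 <= k <oo) (expR (s * k%:R))%:E *
    P [set w | counting ((Y w : set R) `&` B) = k%:R%:E :> \bar R].
Proof.
move=> mB Bab.
pose A k : set T := [set w | counting ((Y w : set R) `&` B) = k%:R%:E :> \bar R].
have mA k : measurable (A k).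
  have := measurableT_comp (measurable_counting_in mB) Ypp.1.
  move=> /(_ measurableT [set k%:R%:E] (emeasurable_set1 _)).
  by rewrite setTI.
transitivity (\int[P]_w \sum_(0 <= k <oo) ((expR (s * k%:R))%:E * (\1_(A k) w)%:E)).
  apply: eq_integral => w _.
  have fw : finite_set ((Y w : set R) `&` B) by exact: finite_point_process Bab.
  set n := #|` fset_set ((Y w : set R) `&` B)|.
  have An k : A k w -> k = n.
    by rewrite /A/= counting_cnt// cntE// => -[] /eqP; rewrite eqr_nat => /eqP.
  have Anw : A n w by rewrite /A/= counting_cnt// cntE.
  rewrite (nneseriesD1 (n := n))//=.
  rewrite indicE mem_set//= mule1 cntE// eseries0 ?adde0// => k _ /= kn.
  by rewrite indicE memNset ?mule0// => /An /eqP; exact/negP.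
rewrite integral_nneseries//; last first.
  by move=> k; apply: emeasurable_funM => //; apply/measurable_EFinP.
apply: eq_eseriesr => k _; rewrite ge0_integralZl_EFin ?expR_ge0//; last exact/measurable_EFinP.
by rewrite integral_indic// setIT.
Qed.

(** Translating the window by [x] amounts to translating the points by [- x]. *)
Lemma stationary_counting (a b x : R) (k : nat) : stationary P Y ->
  P [set w | counting ((Y w : set R) `&` `[(a + x)%R, (b + x)%R]) = k%:R%:E :> \bar R] =
  P [set w | counting ((Y w : set R) `&` `[a, b]) = k%:R%:E :> \bar R].
Proof.
move=> Ystat.
have := Ystat (- x)%R [set Z | counting ((Z : set R) `&` `[a, b]) = k%:R%:E :> \bar R].
move=> /(_ _)/wrap[|/= <-].
  have := measurable_counting_in (measurable_itv `[a, b]).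
  by move=> /(_ measurableT [set k%:R%:E] (emeasurable_set1 _)); rewrite setTI.
have E w : counting ([set (- x + y)%R | y in (Y w : set R)] `&` `[a, b]) =
    counting ((Y w : set R) `&` `[(a + x)%R, (b + x)%R]) :> \bar R.
  rewrite -[RHS](@counting_inj_image _ _ (fun y => - x + y)%R); last 2 first.
    by move=> y z /addrI.
    exact: Ypp.2.
  congr counting; apply/seteqP; split => z /=.
    move=> [[y Yy <-]]; rewrite in_itv/= => yab; exists y => //; split => //.
    by rewrite in_itv/=; lra.
  move=> [y []]; rewrite in_itv/= => Yy yab <-; split; first by exists y.
  by rewrite in_itv/=; lra.
by congr (P _); apply/seteqP; split => w /=; rewrite E.
Qed.

Lemma stationary_exp_moment (a b x s : R) : stationary P Y ->
  \int[P]_w (expR (s * cnt `[(a + x)%R, (b + x)%R] (Y w)))%:E =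
  \int[P]_w (expR (s * cnt `[a, b] (Y w)))%:E.
Proof.
move=> Ystat; rewrite (integral_expR_cnt _ _ (@subset_refl _ _))//.
rewrite (integral_expR_cnt _ _ (@subset_refl _ _))//.
by apply: eq_eseriesr => k _; rewrite stationary_counting.
Qed.

End process.

Lemma nneseries_exp_coeff (x : R) : (0 <= x)%R ->
  \sum_(0 <= k <oo) (exp_coeff x k)%:E = (expR x)%:E.
Proof.
move=> x0; rewrite /expR -EFin_lim; last exact: is_cvg_series_exp_coeff.
by apply: congr_lim; apply/funext => n /=; rewrite sumEFin.
Qed.

(** The exponential series: with mean [m], the weights
    [exp (s k) m^k exp (- m) / k!] sum to [exp (m (exp s - 1))]. *)
Lemma poisson_exp_moment d (T : measurableType d) (P : probability T R)
    (Y : T -> config R) (lambda : R) (B : set R) (a b s : R) :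
  poisson_process P lambda Y -> (0 < lambda)%R ->
  measurable B -> B `<=` `[a, b] ->
  \int[P]_w (expR (s * cnt B (Y w)))%:E =
  (expR (lambda * fine (lebesgue_measure B) * (expR s - 1)))%:E.
Proof.
move=> [Ypp Ylaw _] l0 mB Bab.
have Bfin : lebesgue_measure B < +oo.
  apply: (@le_lt_trans _ _ (lebesgue_measure `[a, b])).
    by apply: le_measure; rewrite ?inE.
  by rewrite lebesgue_measure_itv /=; case: ifP => _; rewrite ?ltry.
rewrite (integral_expR_cnt P Ypp _ mB Bab).
set m := (lambda * _)%R.
have m0 : (0 <= m)%R by apply: mulr_ge0; [exact: ltW|exact: fine_ge0].
transitivity (\sum_(0 <= k <oo) (expR (- m))%:E * (exp_coeff (m * expR s) k)%:E).
  apply: eq_eseriesr => k _; rewrite Ylaw//= -/m -!EFinM; congr _%:E.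
  by rewrite /exp_coeff/= expRM_natr; clearbody m; rewrite exprMn; ring.
have mes0 : (0 <= m * expR s)%R by rewrite mulr_ge0// expR_ge0.
rewrite nneseriesZl; last by move=> k _; rewrite lee_fin exp_coeff_ge0.
rewrite nneseries_exp_coeff// -EFinM -expRD; congr (expR _)%:E; ring.
Qed.

End counts.
(** * One-dimensional Hausdorff measure of parallel segments *)

Section hausdorff.
Context (R : realType).
Implicit Types (p q : R * R) (A : set (R * R)).
(* The Euclidean distance, not the extended distance of a metric space *)
Local Notation edist := Defs.edist.

Lemma edist_fst p q : (`|p.1 - q.1| <= edist p q)%R.
Proof. by rewrite -sqrtr_sqr ler_sqrt ?addr_ge0 ?sqr_ge0// lerDl sqr_ge0. Qed.

Lemma edist_snd p q : (`|p.2 - q.2| <= edist p q)%R.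
Proof. by rewrite -sqrtr_sqr ler_sqrt ?addr_ge0 ?sqr_ge0// lerDr sqr_ge0. Qed.

Lemma diam_ge0 A : 0 <= diam A.
Proof. by apply: ereal_sup_ubound; left. Qed.

Lemma diam_le A (r : R) : (0 <= r)%R ->
  (forall p q, A p -> A q -> (edist p q <= r)%R) -> diam A <= r%:E.
Proof.
move=> r0 Ar; apply: ge_ereal_sup => _ [->|[p Ap [q Aq <-]]]; rewrite lee_fin//.
exact: Ar.
Qed.

Lemma edist_le_diam A p q : A p -> A q -> (edist p q)%:E <= diam A.
Proof. by move=> Ap Aq; apply: ereal_sup_ubound; right; exists p => //; exists q. Qed.

Lemma diam0 : diam (set0 : set (R * R)) = 0.
Proof. by apply/eqP; rewrite eq_le diam_ge0 andbT; apply: diam_le. Qed.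

(* Every set is measurable here, so that covers by measurable sets are
   arbitrary covers. *)
Let plane := g_sigma_algebraType [set: set (R * R)].

Let gauge (delta : R) (A : set plane) : \bar R :=
  if diam A <= delta%:E then diam A else +oo.

Let gauge0 delta : (0 < delta)%R -> gauge delta set0 = 0.
Proof. by move=> d0; rewrite /gauge diam0 lee_fin ltW. Qed.

Let gauge_ge0 delta A : 0 <= gauge delta A.
Proof. by rewrite /gauge; case: ifP => // _; exact: diam_ge0. Qed.

(** A cover with a piece of diameter larger than [delta] has infinite cost, so
    restricting the covers or penalizing the large pieces gives the same
    infimum; the second form is an outer measure by the general construction. *)
Lemma hausdorff1_deltaE (delta : R) A :
  hausdorff1_delta delta A = mu_ext (gauge delta) (A : set plane).
Proof.
apply/eqP; rewrite eq_le; apply/andP; split; last first.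
  apply: le_ereal_inf_tmp => _ [U [AU Ud] <-].
  apply: ereal_inf_lbound; exists U.
    by split => // k; exact: sub_sigma_algebra.
  by apply: eq_eseriesr => k _; rewrite /gauge Ud.
apply: le_ereal_inf_tmp => _ [U [_ AU] <-].
have [Ud|/existsNP[k /negP kU]] := pselect (forall k, diam (U k) <= delta%:E).
  apply: ereal_inf_lbound; exists U => //.
  by apply: eq_eseriesr => k _; rewrite /gauge Ud.
have -> : \sum_(0 <= n <oo) gauge delta (U n) = +oo; last exact: leey.
apply: (@eseries_pinfty _ _ xpredT k) => //; last by rewrite /gauge (negbTE kU).
by move=> n _; rewrite -ltNye (lt_le_trans _ (gauge_ge0 _ _)).
Qed.

Lemma hausdorff1_delta_sigma_subadditive (delta : R) : (0 < delta)%R ->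
  sigma_subadditive (@hausdorff1_delta R delta).
Proof.
move=> d0 F; rewrite hausdorff1_deltaE.
under eq_eseriesr do rewrite hausdorff1_deltaE.
by have := @mu_ext_sigma_subadditive _ plane R (gauge delta) (gauge_ge0 delta) F.
Qed.

Lemma hausdorff1_delta_ge0 (delta : R) A : 0 <= hausdorff1_delta delta A.
Proof. by rewrite hausdorff1_deltaE; exact: mu_ext_ge0. Qed.

Lemma le_hausdorff1_delta (delta : R) :
  {homo (@hausdorff1_delta R delta) : A B / A `<=` B >-> A <= B}.
Proof. by move=> A B AB; rewrite !hausdorff1_deltaE; exact: le_mu_ext. Qed.

Lemma hausdorff1_delta0 (delta : R) : (0 < delta)%R ->
  hausdorff1_delta delta (set0 : set (R * R)) = 0.
Proof. by move=> d0; rewrite hausdorff1_deltaE mu_ext0// gauge0. Qed.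

Lemma hausdorff1_delta_le (delta : R) A : (0 < delta)%R ->
  hausdorff1_delta delta A <= hausdorff1 A.
Proof. by move=> d0; apply: ereal_sup_ubound; exists delta. Qed.

Let hausdorff1_ge0 A : 0 <= hausdorff1 A.
Proof.
exact: le_trans (hausdorff1_delta_ge0 1 A) (hausdorff1_delta_le _ ltr01).
Qed.

Let hausdorff10 : hausdorff1 (set0 : set (R * R)) = 0.
Proof.
apply/eqP; rewrite eq_le hausdorff1_ge0 andbT.
by apply: ge_ereal_sup => _ [delta /= d0 <-]; rewrite hausdorff1_delta0.
Qed.

Let le_hausdorff1 : {homo (@hausdorff1 R) : A B / A `<=` B >-> A <= B}.
Proof.
move=> A B AB; apply: ge_ereal_sup => _ [delta /= d0 <-].
by apply: le_trans (hausdorff1_delta_le _ d0); exact: le_hausdorff1_delta.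
Qed.

Let hausdorff1_sigma_subadditive : sigma_subadditive (@hausdorff1 R).
Proof.
move=> F; apply: ge_ereal_sup => _ [delta /= d0 <-].
apply: (@le_trans _ _ (\sum_(0 <= k <oo) hausdorff1_delta delta (F k))).
  exact: hausdorff1_delta_sigma_subadditive.
by apply: lee_nneseries => [k _ _|k _]; [exact: hausdorff1_delta_ge0|exact: hausdorff1_delta_le].
Qed.

HB.instance Definition _ := isOuterMeasure.Build R (R * R)%type (@hausdorff1 R)
  hausdorff10 hausdorff1_ge0 le_hausdorff1 hausdorff1_sigma_subadditive.

Lemma outer_measure_bigcup_seq (T : Type) (mu : {outer_measure set T -> \bar R})
    (I : choiceType) (s : seq I) (F : I -> set T) :
  mu (\bigcup_(i in [set` s]) F i) <= \sum_(i <- s) mu (F i).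
Proof.
elim: s => [|i s IH].
  by rewrite big_nil bigcup0 ?outer_measure0.
rewrite big_cons; apply: le_trans (leeD2l _ IH).
apply: le_trans (outer_measureU2 _ _ _).
apply: le_outer_measure => x [j /=]; rewrite in_cons => /predU1P[->|js] Fx.
  by left.
by right; exists j.
Qed.

(** The interval is cut into [n] pieces of length [h <= delta]. *)
Lemma hausdorff1_delta_lipschitz_itv (f : R -> R * R) (delta a b : R) :
  (forall s t, edist (f s) (f t) <= `|s - t|)%R -> (0 < delta)%R -> (a <= b)%R ->
  hausdorff1_delta delta (f @` `]a, b]) <= (b - a)%:E.
Proof.
move=> f_lip d0 ab.
pose n := (Num.truncn ((b - a) / delta)).+1.
have n0 : (0 < n%:R :> R)%R by rewrite ltr0n.
pose h := ((b - a) / n%:R)%R.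
have hd : (h <= delta)%R.
  by rewrite ler_pdivrMr// mulrC -ler_pdivrMr// ltW// truncnS_gt.
have h0 : (0 <= h)%R by rewrite divr_ge0// subr_ge0.
pose U k := if (k < n)%N then f @` `](a + h * k%:R)%R, (a + h * k.+1%:R)%R]
  else set0.
have Uh k : diam (U k) <= (if (k < n)%N then h else 0)%:E.
  rewrite /U; case: ifP => _; last by rewrite diam0.
  apply: diam_le => // _ _ [s /= sk <-] [t /= tk <-].
  apply: le_trans (f_lip s t) _; move: sk tk; rewrite !in_itv/= -natr1 => sk tk.
  by rewrite ler_norml; lra.
apply: (@le_trans _ _ (\sum_(0 <= k <oo) diam (U k))).
  apply: ereal_inf_lbound; exists U => //; split; last first.
    move=> k; apply: le_trans (Uh k) _; rewrite lee_fin.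
    by case: ifP => _; [exact: hd|exact: ltW].
  move=> _ [t /= tab <-]; move: tab; rewrite in_itv/= => /andP[at_ tb].
  have anh : (a + h * n%:R = b)%R by rewrite divfK ?gt_eqF// addrC subrK.
  have ex : exists k, (t <= a + h * k.+1%:R)%R by exists n.-1; rewrite anh.
  case: (ex_minnP ex) => k tk kmin; exists k => //.
  rewrite /U (leq_ltn_trans (kmin n.-1 _)) ?anh//; exists t => //=.
  rewrite in_itv/= tk andbT; case: k kmin {tk} => [|k] kmin.
    by rewrite mulr0 addr0.
  by rewrite ltNge; apply/negP => /kmin; rewrite ltnn.
apply: (@le_trans _ _ (\sum_(0 <= k <oo) (if (k < n)%N then h else 0)%:E)).
  by apply: lee_nneseries => [k _ _|k _]; [exact: diam_ge0|exact: Uh].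
rewrite (nneseries_split 0 n)//; last by move=> k _; case: ifP; rewrite lee_fin.
rewrite add0n [X in _ + X]eseries0 ?adde0; last first.
  by move=> k nk _; rewrite ltnNge nk.
rewrite big_mkord sumEFin lee_fin (eq_bigr (fun=> h)); last by move=> i _; rewrite ltn_ord.
by rewrite sumr_const card_ord -[X in (X <= _)%R]mulr_natr divfK// gt_eqF.
Qed.

(** Lebesgue measure is itself an infimum over covers by half-open intervals, and
    the image of each of them is controlled by its length. *)
Lemma hausdorff1_lipschitz (f : R -> R * R) (U : set R) :
  (forall s t, edist (f s) (f t) <= `|s - t|)%R ->
  hausdorff1 (f @` U) <= lebesgue_measure U.
Proof.
move=> f_lip; apply: ge_ereal_sup => _ [delta /= d0 <-].
apply: le_ereal_inf_tmp => _ [A [mA UA] <-].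
apply: (@le_trans _ _ (\sum_(0 <= k <oo) hausdorff1_delta delta (f @` A k))).
  apply: le_trans (hausdorff1_delta_sigma_subadditive d0 _).
  apply: le_hausdorff1_delta => _ [t Ut <-].
  by have [k _ At] := UA _ Ut; exists k => //; exists t.
apply: lee_nneseries => [k _ _|k _]; first exact: hausdorff1_delta_ge0.
have [[a b] _ /= <-] := mA k.
have [ab|ba] := leP a b.
  rewrite wlength_itv_bnd//; exact: hausdorff1_delta_lipschitz_itv.
rewrite set_itv_ge; last by rewrite bnd_simp -leNgt ltW.
by rewrite image_set0 hausdorff1_delta0// wlength0.
Qed.

Lemma pos_lower_bound (T : eqType) (s : seq T) (f : T -> R) :
  exists2 e : R, (0 < e)%R & forall x, x \in s -> (0 < f x)%R -> (e <= f x)%R.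
Proof.
elim: s => [|y s [e e0 es]]; first by exists 1%R.
have [fy|fy] := leP (f y) 0%R.
  by exists e => // x; rewrite in_cons => /predU1P[->|/es//]; rewrite ltNge fy.
exists (Num.min e (f y)); first by rewrite lt_min e0.
move=> x; rewrite in_cons => /predU1P[->|/es es'] fx; rewrite ge_min ?lexx ?orbT//.
by rewrite es'.
Qed.

(** A lower bound for the length of unit segments on parallel lines, with [p1]
    and [p2] the coordinates across and along the lines.  If the pieces of a
    cover are smaller than the gap between two lines, each piece meets at most
    one line, and there its trace is contained in an interval of twice its
    diameter, centred at any of its points; hence the factor [2]. *)
Lemma counting_le_hausdorff1 (p1 p2 : R * R -> R) (mk : R -> R -> R * R)
    (Y : set R) A :
  (forall p q, `|p1 p - p1 q| <= edist p q)%R ->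
  (forall p q, `|p2 p - p2 q| <= edist p q)%R ->
  (forall y t, p1 (mk y t) = y) -> (forall y t, p2 (mk y t) = t) ->
  finite_set Y ->
  (forall y t, Y y -> (- 2^-1 <= t <= 2^-1)%R -> A (mk y t)) ->
  counting Y <= 2%:E * hausdorff1 A.
Proof.
move=> lip1 lip2 mk1 mk2 fY YA.
set s := fset_set Y.
have [e e0 e_gap] := pos_lower_bound [seq (y, z) | y <- s, z <- s]
  (fun yz => `|yz.1 - yz.2|%R).
have gap y z : y \in s -> z \in s -> (`|y - z| < e)%R -> y = z.
  move=> ys zs yze; apply/eqP/negPn/negP => yz.
  have := e_gap (y, z) (allpairs_f _ ys zs).
  by rewrite /= normr_gt0 subr_eq0 => /(_ yz); rewrite leNgt yze.
pose delta := (e / 2)%R.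
have d0 : (0 < delta)%R by rewrite divr_gt0.
apply: le_trans (lee_wpmul2l _ (hausdorff1_delta_le A d0)) => //.
rewrite -lee_pdivrMl//.
apply: le_ereal_inf_tmp => _ [U [AU Ud] <-].
rewrite lee_pdivrMl// -nneseriesZl; last by move=> k _; exact: diam_ge0.
have Ufin n : diam (U n) \is a fin_num.
  rewrite ge0_fin_numE ?diam_ge0//; exact: le_lt_trans (Ud n) (ltry _).
(* The trace of [U n] on the line [y], enlarged to a measurable set *)
pose K n y : set R := if pselect (exists q, U n q /\ p1 q = y) is left ex then
  `[(p2 (sval (cid ex)) - fine (diam (U n)))%R,
    (p2 (sval (cid ex)) + fine (diam (U n)))%R]%classic else set0.
have mK n y : measurable (K n y) by rewrite /K; case: pselect.
have cover y : y \in s -> 1 <= \sum_(0 <= n <oo) lebesgue_measure (K n y).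
  move=> ys.
  have -> : 1 = lebesgue_measure `[(- 2^-1)%R, 2^-1%R] :> \bar R.
    rewrite lebesgue_measure_itv/= lte_fin ifT; last by lra.
    by rewrite -EFinB; congr _%:E; lra.
  apply: measure_sigma_subadditive => //; first by move=> n; exact: mK.
  move=> t /= ty.
  have [n _ Unt] : (\bigcup_n U n) (mk y t).
    apply/AU/YA; last by move: ty; rewrite in_itv.
    by move: ys; rewrite in_fset_set// inE.
  exists n => //; rewrite /K; case: pselect => [ex|[]]; last by exists (mk y t).
  case: (cid ex) => q [/= Unq _]; rewrite in_itv/=.
  have : (`|p2 (mk y t) - p2 q| <= fine (diam (U n)))%R.
    apply: le_trans (lip2 _ _) _; rewrite -lee_fin fineK//.
    exact: edist_le_diam.
  by rewrite mk2 ler_norml; lra.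
have Kdiam n : \sum_(y <- s) lebesgue_measure (K n y) <= 2%:E * diam (U n).
  have [[y [ys [q [Uq qy]]]]|none] := pselect (exists y, y \in s /\
      exists q, U n q /\ p1 q = y); last first.
    rewrite big_seq big1 ?mule_ge0 ?diam_ge0// => y ys.
    rewrite /K; case: pselect => [ex|_]; last exact: measure0.
    by exfalso; apply: none; exists y.
  rewrite (bigD1_seq y)//= big_seq_cond big1 ?adde0.
    rewrite /K; case: pselect => [ex|_]; last by rewrite measure0 mule_ge0// diam_ge0.
    rewrite lebesgue_measure_itv/=; case: ifP => _; last by rewrite mule_ge0// diam_ge0.
    rewrite -[in leRHS](fineK (Ufin n)) -EFinB -EFinM lee_fin; lra.
  move=> z /andP[zs zy]; rewrite /K; case: pselect => [[q' [Uq' q'z]]|_]; last exact: measure0.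
  exfalso; move/eqP: zy; apply; apply: gap => //.
  rewrite -q'z -qy; apply: le_lt_trans (lip1 _ _) _.
  rewrite -lte_fin; apply: le_lt_trans (edist_le_diam Uq' Uq) _.
  by apply: le_lt_trans (Ud n) _; rewrite lte_fin ltr_pdivrMr// ltr_pMr// ltr1n.
rewrite /counting asboolT// -/s.
apply: (@le_trans _ _ (\sum_(y <- s) \sum_(0 <= n <oo) lebesgue_measure (K n y))).
  apply: (@le_trans _ _ (\sum_(y <- s) 1)).
    by rewrite sumEFin lee_fin big_const_seq count_predT iter_addr_0.
  by rewrite !big_seq; apply: lee_sum.
rewrite -nneseries_sum//.
by apply: lee_nneseries => [n _ _|n _]; [exact: sume_ge0|exact: Kdiam].
Qed.

End hausdorff.
(** * Lower limits of extended real sequences *)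

Section lower_limits.
Context (R : realType).
Implicit Types (u v : (\bar R)^nat) (x : \bar R).

Lemma einfs_le_limn_einf u n : einfs u n <= limn_einf u.
Proof.
rewrite limn_einf_lim (cvg_lim _ (@cvg_einfs_sup _ u))//.
by apply: ereal_sup_ubound; exists n.
Qed.

Lemma le_einfs u x n : (forall m, (n <= m)%N -> x <= u m) -> x <= einfs u n.
Proof. by move=> xu; apply: le_ereal_inf_tmp => _ [m /= nm <-]; exact: xu. Qed.

Lemma einfs_le u n : einfs u n <= u n.
Proof. by apply: ereal_inf_lbound; exists n => /=. Qed.

Lemma limn_einf_ge u x n : (forall m, (n <= m)%N -> x <= u m) -> x <= limn_einf u.
Proof. by move=> /le_einfs /le_trans; apply; exact: einfs_le_limn_einf. Qed.

Lemma lt_limn_einf u x : x < limn_einf u ->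
  exists n, x < einfs u n.
Proof.
rewrite limn_einf_lim (cvg_lim _ (@cvg_einfs_sup _ u))// => /ereal_sup_gt.
by move=> [_ [n _ <-] xn]; exists n.
Qed.

Lemma le_limn_einf u v n : (forall m, (n <= m)%N -> u m <= v m) ->
  limn_einf u <= limn_einf v.
Proof.
move=> uv; rewrite [leLHS]limn_einf_lim; apply: lime_le; first exact: is_cvg_einfs.
apply: nearW => k; apply: (@limn_einf_ge _ _ (maxn n k)) => m.
rewrite geq_max => /andP[nm km]; apply: le_trans (uv _ nm).
by apply: ereal_inf_lbound; exists m.
Qed.

Lemma limn_einf_le u x : (forall n, u n <= x) -> limn_einf u <= x.
Proof.
move=> ux; rewrite limn_einf_lim; apply: lime_le; first exact: is_cvg_einfs.
by apply: nearW => n; apply: le_trans (einfs_le _ _) _.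
Qed.

Lemma limn_einf_ge0 u : (forall n, 0 <= u n) -> 0 <= limn_einf u.
Proof. by move=> u0; apply: (@limn_einf_ge _ _ 0%N) => m _. Qed.

(** Lower limits are superadditive. *)
Lemma limn_einfD_ge u v : (forall n, 0 <= u n) -> (forall n, 0 <= v n) ->
  limn_einf u + limn_einf v <= limn_einf (fun n => u n + v n).
Proof.
move=> u0 v0.
have e0 (w : (\bar R)^nat) n : (forall n, 0 <= w n) -> 0 <= einfs w n.
  by move=> w0; apply: le_einfs => m _; exact: w0.
rewrite [limn_einf u]limn_einf_lim [limn_einf v]limn_einf_lim.
rewrite -limeD; [|exact: is_cvg_einfs|exact: is_cvg_einfs|]; last first.
  apply: ge0_adde_def; rewrite inE; apply: lime_ge;
    [exact: is_cvg_einfs| |exact: is_cvg_einfs|]; apply: nearW => n; exact: e0.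
apply: lime_le.
  by apply: is_cvgeD; [|exact: is_cvg_einfs|exact: is_cvg_einfs];
    apply: ge0_adde_def; rewrite inE; apply: lime_ge;
    [exact: is_cvg_einfs| |exact: is_cvg_einfs|]; apply: nearW => n; exact: e0.
apply: nearW => n /=; apply: (@limn_einf_ge _ _ n) => m nm.
by apply: leeD; apply: ereal_inf_lbound; exists m.
Qed.

Lemma limn_einf_sum_ge (I : Type) (s : seq I) (f : I -> (\bar R)^nat) :
  (forall i n, 0 <= f i n) ->
  \sum_(i <- s) limn_einf (f i) <= limn_einf (fun n => \sum_(i <- s) f i n).
Proof.
move=> f0; elim: s => [|i s IH].
  by rewrite big_nil; apply: limn_einf_ge0 => n; rewrite big_nil.
rewrite big_cons.
have -> : (fun n => \sum_(j <- i :: s) f j n) =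
    (fun n => f i n + \sum_(j <- s) f j n).
  by apply/funext => n; rewrite big_cons.
apply: le_trans (limn_einfD_ge (f0 i) _); first exact: leeD2l.
by move=> n; exact: sume_ge0.
Qed.

(** Write the right-hand side as [expeR b]: if [b] were smaller than
    [a * limn_einf u], it would be smaller than [a] times a tail infimum of [u]. *)
Lemma expeR_limn_einf (a : R) u : (0 < a)%R ->
  expeR (a%:E * limn_einf u) <= limn_einf (fun n => expeR (a%:E * u n)).
Proof.
move=> a0; set L := limn_einf (fun n => expeR _).
have L0 : 0 <= L by apply: limn_einf_ge0 => n /=; exact: expeR_ge0.
rewrite leNgt; apply/negP => Lu.
have [b bL] := expeR_total L0.
move: Lu; rewrite -bL lte_expeR => Lu.
move: Lu; rewrite -lte_pdivrMl// => /lt_limn_einf[n].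
rewrite lte_pdivrMl// -lte_expeR bL => Ln.
have : L < L; last by rewrite ltxx.
apply: lt_le_trans Ln _; apply: (@limn_einf_ge _ _ n) => m nm.
rewrite lee_expeR lee_pmul2l ?lte_fin//.
by apply: ereal_inf_lbound; exists m.
Qed.

(** Fatou's lemma for indicator functions. *)
Lemma lebesgue_le_limn_einf (A : set R) (W : (set R)^nat) : measurable A ->
  (forall n, measurable (W n)) ->
  (forall t, A t -> exists n, forall m, (n <= m)%N -> W m t) ->
  lebesgue_measure A <= limn_einf (fun n => lebesgue_measure (W n)).
Proof.
move=> mA mW AW.
have lebE (B : set R) : measurable B ->
    lebesgue_measure B = \int[lebesgue_measure]_x (\1_B x)%:E.
  by move=> mB; rewrite integral_indic// setIT.
have -> : (fun n => lebesgue_measure (W n)) =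
    (fun n => \int[lebesgue_measure]_x (\1_(W n) x)%:E).
  by apply/funext => n; exact: lebE.
rewrite lebE//.
have mW1 n : measurable_fun setT (fun x : measurableTypeR R => (\1_(W n) x : R)%:E).
  by apply/measurable_EFinP; apply: measurable_indic; exact: mW.
have W0 n (x : R) : setT x -> 0 <= (\1_(W n) x : R)%:E by move=> _; rewrite lee_fin.
apply: le_trans _ (fatou lebesgue_measure measurableT mW1 W0).
apply: le_integral_of_le => x; first by rewrite lee_fin.
rewrite indicE; have [/set_mem/AW[n nW]|_] := boolP (x \in A).
  by apply: (@limn_einf_ge _ _ n) => m nm; rewrite indicE mem_set//; exact: nW.
by apply: limn_einf_ge0 => n; rewrite lee_fin.
Qed.

End lower_limits.

(** * Grids and edge lengths inside an open set *)

Section grid.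
Context (R : realType).
Implicit Types (n k : nat) (C : set (R * R)) (Y : config R).

(** The grid divides [-1, 2[ into [n.+1] intervals; the margin beyond [1] lets
    half-open intervals cover the projection [-1, 1] of the disk. *)
Definition mesh n : R := (3 / n.+1%:R)%R.
Definition node n k : R := (mesh n * k%:R - 1)%R.
Definition gcell n k : set R := `[node n k, node n k.+1[%classic.

Lemma mesh_gt0 n : (0 < mesh n)%R.
Proof. by rewrite divr_gt0. Qed.

Lemma mesh_size n : (mesh n * n.+1%:R = 3)%R.
Proof. by rewrite divfK. Qed.

Lemma node_le n k l : (node n k <= node n l)%R = (k <= l)%N.
Proof. by rewrite lerD2r ler_pM2l ?mesh_gt0// ler_nat. Qed.

Lemma nodeS n k : node n k.+1 = (node n k + mesh n)%R.
Proof. by rewrite /node -natr1; ring. Qed.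

Lemma measurable_gcell n k : measurable (gcell n k).
Proof. exact: measurable_itv. Qed.

Lemma lebesgue_gcell n k : lebesgue_measure (gcell n k) = (mesh n)%:E.
Proof.
rewrite lebesgue_measure_itv/= lte_fin nodeS ltrDl mesh_gt0.
by rewrite -EFinB addrAC subrr add0r.
Qed.

Lemma gcell_sub n k : (k < n.+1)%N -> gcell n k `<=` `[(-1)%R, 2%R].
Proof.
move=> kn t; rewrite /gcell/= !in_itv/= => /andP[kt tk].
have : (node n 0 <= node n k)%R by rewrite node_le.
have : (node n k.+1 <= node n n.+1)%R by rewrite node_le.
rewrite /node mulr0 mesh_size in kt tk * => h1 h2.
by apply/andP; split; lra.
Qed.

Lemma trivIset_gcell n : trivIset setT (gcell n).
Proof.
apply/trivIsetP => k l _ _ kl; apply/seteqP; split => // t [].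
rewrite /gcell/= !in_itv/= => /andP[kt tk] /andP[lt_ tl].
have := le_lt_trans kt tl; have := le_lt_trans lt_ tk.
rewrite !ltNge !node_le -!ltnNge !ltnS => lk kl'.
by move/negP: kl; apply; rewrite eqn_leq kl' lk.
Qed.

Lemma gcell_cover n (t : R) : (-1 <= t < 2)%R ->
  exists k : 'I_n.+1, gcell n k t.
Proof.
move=> /andP[t1 t2]; have m0 := mesh_gt0 n.
have tm0 : (0 <= (t + 1) / mesh n)%R by apply: divr_ge0; [lra|exact: ltW].
have /andP[lo hi] := truncn_itv tm0.
have kn : (Num.truncn ((t + 1) / mesh n) < n.+1)%N.
  rewrite truncn_lt_nat// ltr_pdivrMr// [ltRHS]mulrC mesh_size. lra.
exists (Ordinal kn); rewrite /gcell/= in_itv/= /node.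
move: lo hi; rewrite ler_pdivlMr// ltr_pdivrMr// ![(_ * mesh n)%R]mulrC => lo hi.
by apply/andP; split; lra.
Qed.

Lemma mesh_cvg (e : R) : (0 < e)%R -> exists n0, forall n, (n0 <= n)%N -> (mesh n < e)%R.
Proof.
move=> e0; exists (Num.truncn (3 / e)) => n nn.
rewrite ltr_pdivrMr// [ltRHS]mulrC -ltr_pdivrMr//.
by apply: lt_le_trans (truncnS_gt _) _; rewrite ler_nat ltnS.
Qed.

(** A square of the grid is assigned to [C] by its lower left corner only: this
    makes the assignment depend on the membership of finitely many points, and
    disjoint sets receive disjoint sets of squares. *)
Definition nodes_in n C : {set 'I_n.+1 * 'I_n.+1} :=
  [set kl : 'I_n.+1 * 'I_n.+1 | `[< C (node n kl.1, node n kl.2) >]]%SET.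

(** The total length inside the squares [V] of the vertical lines based on [Y]:
    each point of [Y] contributes one side of every square of its column. *)
Definition vlength n (V : {set 'I_n.+1 * 'I_n.+1}) Y : R :=
  (mesh n * \sum_(kl in V) cnt (gcell n kl.1) Y)%R.

Definition hlength n (V : {set 'I_n.+1 * 'I_n.+1}) Y : R :=
  (mesh n * \sum_(kl in V) cnt (gcell n kl.2) Y)%R.

Lemma vlength_ge0 n V Y : (0 <= @vlength n V Y)%R.
Proof.
by apply: mulr_ge0; [exact/ltW/mesh_gt0|apply: sumr_ge0 => kl _; exact: cnt_ge0].
Qed.

Lemma hlength_ge0 n V Y : (0 <= @hlength n V Y)%R.
Proof.
by apply: mulr_ge0; [exact/ltW/mesh_gt0|apply: sumr_ge0 => kl _; exact: cnt_ge0].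
Qed.

(** The corners of the squares that contain [(y, t)] converge to [(y, t)]. *)
Lemma open_nodes C (y t : R) : open C -> C (y, t) ->
  exists n0, forall n k l, (n0 <= n)%N -> gcell n k y -> gcell n l t ->
    C (node n k, node n l).
Proof.
move=> oC Cyt.
have /nbhs_ballP[e /= e0 eC] : nbhs (y, t) C by exact: open_nbhs_nbhs.
have [n0 n0e] := mesh_cvg e0.
exists n0 => n k l /n0e ne; rewrite /gcell/= !in_itv/= !nodeS => yk tl.
by apply: eC; split => /=; rewrite /ball/= ltr_norml; lra.
Qed.

Lemma measurable_section C (y : R) : open C -> measurable [set t | C (y, t)].
Proof.
move=> oC; apply: open_measurable.
apply: (@open_comp _ _ (fun t : R => (y, t)) C) => // t _.
by apply: (@cvg_pair _ _ _ _ (nbhs y) (nbhs t)); [exact: cvg_cst|exact: cvg_id].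
Qed.

(* The section at abscissa [y] of the union of the squares assigned to [C] *)
Let wsec n C y : set R :=
  \big[setU/set0]_(kl in nodes_in n C | y \in gcell n kl.1) gcell n kl.2.

Lemma sum_sections_le_vlength C (s : seq R) n Y : uniq s ->
  finite_set ((Y : set R) `&` `[(-1)%R, 2%R]) ->
  (forall y, y \in s -> Y y) ->
  \sum_(y <- s) lebesgue_measure (wsec n C y) <= (vlength (nodes_in n C) Y)%:E.
Proof.
move=> us fY sY.
apply: (@le_trans _ _ (\sum_(y <- s)
    (\sum_(kl in nodes_in n C) (y \in gcell n kl.1)%:R * mesh n)%:E)).
  apply: lee_sum => y _; rewrite -sumEFin.
  suff [] : measurable (wsec n C y) /\ lebesgue_measure (wsec n C y) <=
      \sum_(kl in nodes_in n C) ((y \in gcell n kl.1)%:R * mesh n)%:E by [].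
  rewrite /wsec big_mkcondr/=.
  elim/big_rec2: _ => [|kl x B _ [mB Bx]]; first by rewrite measure0.
  case: (y \in gcell n kl.1); last by rewrite set0U mul0r add0e.
  have mk := measurable_gcell n kl.2.
  split; first exact: measurableU.
  apply: (@le_trans _ _ (lebesgue_measure (gcell n kl.2) + lebesgue_measure B)).
    exact: measureU2.
  by rewrite lebesgue_gcell mul1r leeD2l.
rewrite sumEFin lee_fin exchange_big/= /vlength mulr_sumr.
apply: ler_sum => kl _; rewrite -mulr_suml mulrC ler_pM2l ?mesh_gt0//.
have fk : finite_set ((Y : set R) `&` gcell n kl.1).
  by apply: sub_finite_set fY; apply: setIS; exact: gcell_sub.
rewrite cntE// -natr_sum ler_nat.
have -> : (\sum_(y <- s) (y \in gcell n kl.1))%N =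
    size [seq y <- s | y \in gcell n kl.1].
  by rewrite size_filter -sum1_count [RHS]big_mkcond; apply: eq_bigr => y _; case: ifP.
apply: uniq_leq_size; first exact: filter_uniq.
move=> y; rewrite mem_filter in_fset_set// => /andP[/set_mem yk ys].
by apply/mem_set; split => //; exact: sY.
Qed.

(** By [open_nodes] the grid sections eventually contain every point of the true
    section. *)
Lemma sum_sections_le_limn_einf C Y : open C ->
  (forall a b, finite_set ((Y : set R) `&` `[a, b])) ->
  \sum_(y <- fset_set ((Y : set R) `&` `[(-1)%R, 1%R]))
    lebesgue_measure ([set t | C (y, t)] `&` `[(-1)%R, 1%R]) <=
  limn_einf (fun n => (vlength (nodes_in n C) Y)%:E).
Proof.
move=> oC fY; set s := fset_set _.
have sP y : y \in s -> Y y /\ (-1 <= y <= 1)%R.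
  by rewrite in_fset_set// => /set_mem /=; rewrite in_itv/=.
apply: (@le_trans _ _ (\sum_(y <- s)
    limn_einf (fun n => lebesgue_measure (wsec n C y)))).
  rewrite !big_seq; apply: lee_sum => y /sP[Yy y1].
  apply: lebesgue_le_limn_einf.
  - by apply: measurableI => //; exact: measurable_section.
  - by move=> n; apply: bigsetU_measurable => kl _; exact: measurable_gcell.
  - move=> t [/= Cyt]; rewrite in_itv/= => t1.
    have [n0 n0C] := open_nodes oC Cyt; exists n0 => n n0n.
    have [|k ky] := @gcell_cover n y; first by lra.
    have [|l lt_] := @gcell_cover n t; first by lra.
    rewrite /wsec (bigD1 (k, l)) /=; first by left.
    by rewrite inE mem_set// andbT; apply/asboolP; exact: n0C.
apply: le_trans (limn_einf_sum_ge _ _) _ => //.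
apply: (@le_limn_einf _ _ _ 0%N) => n _; apply: sum_sections_le_vlength => //.
  exact: fset_uniq.
by move=> y /sP[].
Qed.

(** Exchanging the coordinates reduces horizontal lines to vertical ones. *)
Lemma hlengthE n C Y :
  hlength (nodes_in n C) Y = vlength (nodes_in n [set p | C (p.2, p.1)]) Y.
Proof.
rewrite /hlength /vlength; congr (_ * _)%R.
have swap_inj : injective (fun kl : 'I_n.+1 * 'I_n.+1 => (kl.2, kl.1)).
  by move=> [k l] [k' l'] /= [-> ->].
rewrite (reindex_inj swap_inj)/=.
by apply: eq_bigl => kl; rewrite !inE.
Qed.

End grid.
(** * Edge lengths of Manhattan grids and of the nested tessellation *)

Section lengths.
Context (R : realType).
Implicit Types (C : set (R * R)) (Y : config R).

Definition locally_finite Y := forall a b, finite_set ((Y : set R) `&` `[a, b]).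

Lemma unit_disk_fst (p : R * R) : unit_disk p -> (-1 <= p.1 <= 1)%R.
Proof. by rewrite /unit_disk/= => p1; apply/andP; split; nra. Qed.

Lemma unit_disk_snd (p : R * R) : unit_disk p -> (-1 <= p.2 <= 1)%R.
Proof. by rewrite /unit_disk/= => p1; apply/andP; split; nra. Qed.

Lemma hausdorff1_vertical_le C Y : locally_finite Y ->
  hausdorff1 [set p | [/\ (Y : set R) p.1, C p & unit_disk p]] <=
  \sum_(y <- fset_set ((Y : set R) `&` `[(-1)%R, 1%R]))
    lebesgue_measure ([set t | C (y, t)] `&` `[(-1)%R, 1%R]).
Proof.
move=> fY; apply: (@le_trans _ _ (\sum_(y <- fset_set ((Y : set R) `&` `[(-1)%R, 1%R]))
  hausdorff1 ((pair y) @` ([set t | C (y, t)] `&` `[(-1)%R, 1%R])))).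
  apply: le_trans (outer_measure_bigcup_seq _ _ _).
  apply: le_outer_measure => -[y t] [/= Yy Cyt Dyt]; exists y => /=.
    rewrite in_fset_set//; apply/mem_set; split => //.
    exact: unit_disk_fst Dyt.
  by exists t => //; split => //; exact: unit_disk_snd Dyt.
apply: lee_sum => y _; apply: hausdorff1_lipschitz => s t.
by rewrite /Defs.edist/= subrr expr0n add0r sqrtr_sqr.
Qed.

Lemma hausdorff1_horizontal_le C Y : locally_finite Y ->
  hausdorff1 [set p | [/\ (Y : set R) p.2, C p & unit_disk p]] <=
  \sum_(y <- fset_set ((Y : set R) `&` `[(-1)%R, 1%R]))
    lebesgue_measure ([set t | C (t, y)] `&` `[(-1)%R, 1%R]).
Proof.
move=> fY; apply: (@le_trans _ _ (\sum_(y <- fset_set ((Y : set R) `&` `[(-1)%R, 1%R]))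
  hausdorff1 ((fun t => (t, y)) @` ([set t | C (t, y)] `&` `[(-1)%R, 1%R])))).
  apply: le_trans (outer_measure_bigcup_seq _ _ _).
  apply: le_outer_measure => -[t y] [/= Yy Cyt Dyt]; exists y => /=.
    rewrite in_fset_set//; apply/mem_set; split => //.
    exact: unit_disk_snd Dyt.
  by exists t => //; split => //; exact: unit_disk_fst Dyt.
apply: lee_sum => y _; apply: hausdorff1_lipschitz => s t.
by rewrite /Defs.edist/= subrr expr0n addr0 sqrtr_sqr.
Qed.

Lemma hausdorff1_manhattan_le C Yv Yh :
  hausdorff1 (manhattan Yv Yh `&` C `&` unit_disk) <=
  hausdorff1 [set p | [/\ (Yv : set R) p.1, C p & unit_disk p]] +
  hausdorff1 [set p | [/\ (Yh : set R) p.2, C p & unit_disk p]].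
Proof.
apply: le_trans (outer_measureU2 _ _ _); apply: le_outer_measure => p [[+ Cp] Dp].
by move=> [[y Yy /= py]|[y Yy /= py]]; [right|left]; rewrite /= py.
Qed.

Lemma hausdorff1_manhattan_open_le C Yv Yh : open C ->
  locally_finite Yv -> locally_finite Yh ->
  hausdorff1 (manhattan Yv Yh `&` C `&` unit_disk) <=
  limn_einf (fun n => (vlength (nodes_in n C) Yv + hlength (nodes_in n C) Yh)%:E).
Proof.
move=> oC fv fh.
have oC' : open [set p | C (p.2, p.1)].
  apply: (@open_comp _ _ (fun p : R * R => (p.2, p.1)) C) => // p _.
  by apply: (@cvg_pair _ _ _ _ (nbhs p.2) (nbhs p.1)); [exact: cvg_snd|exact: cvg_fst].
have -> : (fun n => (vlength (nodes_in n C) Yv + hlength (nodes_in n C) Yh)%:E) =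
    (fun n => (vlength (nodes_in n C) Yv)%:E + (hlength (nodes_in n C) Yh)%:E).
  by apply/funext => n; rewrite EFinD.
apply: le_trans (limn_einfD_ge _ _); [|by move=> n; rewrite lee_fin vlength_ge0|by move=> n; rewrite lee_fin hlength_ge0].
apply: le_trans (hausdorff1_manhattan_le _ _ _) _; apply: leeD.
  by apply: le_trans (hausdorff1_vertical_le _ fv) _; exact: sum_sections_le_limn_einf.
apply: le_trans (hausdorff1_horizontal_le _ fh) _.
have -> : (fun n => (hlength (nodes_in n C) Yh)%:E) =
    (fun n => (vlength (nodes_in n [set p | C (p.2, p.1)]) Yh)%:E).
  by apply/funext => n; rewrite hlengthE.
exact: (@sum_sections_le_limn_einf _ _ _ oC').
Qed.

Lemma hausdorff1_manhattan_disk_le Yv Yh : locally_finite Yv -> locally_finite Yh ->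
  hausdorff1 (manhattan Yv Yh `&` unit_disk) <=
  (2 * (cnt `[(-1)%R, 1%R] Yv + cnt `[(-1)%R, 1%R] Yh))%:E.
Proof.
move=> fv fh; rewrite -[manhattan _ _]setIT mulrDr EFinD.
have len Y : locally_finite Y -> \sum_(y <- fset_set ((Y : set R) `&` `[(-1)%R, 1%R]))
    lebesgue_measure ([set t : R | setT t] `&` `[(-1)%R, 1%R]) =
    (2 * cnt `[(-1)%R, 1%R] Y)%:E.
  move=> fY; rewrite setTI lebesgue_measure_itv/= lte_fin ifT; last by lra.
  rewrite -EFinB sumEFin cntE//; congr _%:E.
  by rewrite big_const_seq count_predT iter_addr_0 mulr_natr; congr (_ *+ _)%R; lra.
apply: le_trans (hausdorff1_manhattan_le _ _ _) _; apply: leeD.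
  by rewrite -len//; exact: hausdorff1_vertical_le.
by rewrite -len//; exact: hausdorff1_horizontal_le.
Qed.

Lemma cnt_le_hausdorff1_manhattan Yv Yh : locally_finite Yv -> locally_finite Yh ->
  let H := hausdorff1 (manhattan Yv Yh `&` unit_disk) in
  let I := `[(- 2^-1)%R, 2^-1%R]%classic in
  (cnt I Yv)%:E <= 2%:E * H /\ (cnt I Yh)%:E <= 2%:E * H.
Proof.
move=> fv fh H I.
have half (y t : R) : (- 2^-1 <= y <= 2^-1)%R -> (- 2^-1 <= t <= 2^-1)%R ->
    (y ^+ 2 + t ^+ 2 <= 1)%R by nra.
have fvI : finite_set ((Yv : set R) `&` I) by exact: fv.
have fhI : finite_set ((Yh : set R) `&` I) by exact: fh.
split; rewrite -counting_cnt//.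
- apply: (@counting_le_hausdorff1 _ fst snd pair) => //.
  + exact: edist_fst.
  + exact: edist_snd.
  + move=> y t [Yy]; rewrite /I/= in_itv/= => yI tI; split; last exact: half.
    by right; exists y.
- apply: (@counting_le_hausdorff1 _ snd fst (fun y t => (t, y))) => //.
  + exact: edist_snd.
  + exact: edist_fst.
  + move=> y t [Yy]; rewrite /I/= in_itv/= => yI tI; split; last exact: half.
    by left; exists y.
Qed.

(** The boundary of [D] lies in [S] and misses [C], so [C `&` D] is both open and
    closed in the connected set [C]. *)
Lemma cell_eq (S C D : set (R * R)) (x : R * R) :
  is_cell S C -> is_cell S D -> C x -> D x -> C = D.
Proof.
wlog suff sub : C D / is_cell S C -> is_cell S D -> C x -> D x -> C `<=` D.
  by move=> cC cD Cx Dx; apply/seteqP; split; exact: sub.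
move=> [_ cnC _ CS _] [_ _ oD _ bD] Cx Dx.
suff <- : C `&` D = C by move=> y [].
apply: cnC; first by exists x.
  by exists D.
exists (closure D); first exact: closed_closure.
apply/seteqP; split => y [Cy Dy]; split => //; first exact: subset_closure.
apply: contrapT => nDy.
have : (C `&` S) y; last by rewrite CS.
by split => //; apply: bD; split => //; move/interior_id : oD => ->.
Qed.

(** Superadditivity of the lower limit allows the sum over the cells and the limit
    of the grids to be taken at the same time: for fixed [m], the first [m] cells
    are among the first [n] as soon as [m <= n]. *)
Lemma hausdorff1_nested_le (Yov Yoh : config R) (J : set nat)
    (C : nat -> set (R * R)) (Yv Yh : nat -> config R) :
  locally_finite Yov -> locally_finite Yoh ->
  (forall i, locally_finite (Yv i)) -> (forall i, locally_finite (Yh i)) ->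
  (forall i, J i -> open (C i)) ->
  hausdorff1 (nested (manhattan Yov Yoh) J C (fun i => manhattan (Yv i) (Yh i))
    `&` unit_disk) <=
  limn_einf (fun n => (2 * (cnt `[(-1)%R, 1%R] Yov + cnt `[(-1)%R, 1%R] Yoh) +
    \sum_(i < n) (vlength (nodes_in n [set x | J i /\ C i x]) (Yv i) +
                  hlength (nodes_in n [set x | J i /\ C i x]) (Yh i)))%:E).
Proof.
move=> fov foh fv fh oC; pose nodes n i := nodes_in n [set x | J i /\ C i x].
set G := (2 * (_ + _))%R.
pose X n i := (vlength (nodes n i) (Yv i) + hlength (nodes n i) (Yh i))%R.
have X0 n i : (0 <= X n i)%R.
  by apply: addr_ge0; [exact: vlength_ge0|exact: hlength_ge0].
pose A i := manhattan (Yv i) (Yh i) `&` [set x | J i /\ C i x] `&` unit_disk.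
have -> : (fun n => (G + \sum_(i < n) X n i)%:E) =
    (fun n => G%:E + (\sum_(i < n) X n i)%:E).
  by apply/funext => n; rewrite EFinD.
rewrite limn_einf_shift//.
apply: (@le_trans _ _ (G%:E + hausdorff1 (\bigcup_i A i))).
  apply: le_trans (leeD2r _ (hausdorff1_manhattan_disk_le fov foh)).
  apply: le_trans (outer_measureU2 _ _ _); apply: le_outer_measure => p.
  by move=> [[So|[i Ji [Si Ci]]] Dp]; [left|right; exists i].
apply: leeD2l; apply: le_trans (outer_measure_sigma_subadditive _ _) _.
apply: lime_le; first exact: is_cvg_nneseries.
apply: nearW => m; rewrite big_mkord.
apply: (@le_trans _ _ (\sum_(i < m) limn_einf (fun n => (X n i)%:E))).
  apply: lee_sum => i _; apply: hausdorff1_manhattan_open_le => //.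
  have [Ji|nJi] := pselect (J i).
    by rewrite (_ : mkset _ = C i); [exact: oC|apply/seteqP; split => x /= // []].
  by rewrite (_ : mkset _ = set0); [exact: open0|apply/seteqP; split => x /= // []].
apply: le_trans (limn_einf_sum_ge _ _) _; first by move=> i n; rewrite lee_fin.
apply: (@le_limn_einf _ _ _ m) => n mn; rewrite sumEFin lee_fin.
rewrite (big_ord_widen n (X n) mn) [leRHS](bigID (fun i : 'I_n => (i < m)%N))/=.
by rewrite lerDl sumr_ge0.
Qed.

End lengths.
(** * Exponential moments *)

Section exponential_moments.
Context d (T : measurableType d) (R : realType) (P : probability T R).
Implicit Types N M : T -> R.

Definition exp_moments N := forall a : R, (0 < a)%R ->
  \int[P]_w (expR (a * N w))%:E < +oo.

Lemma le_exp_moments N M : (forall w, (N w <= M w)%R) -> exp_moments M -> exp_moments N.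
Proof.
move=> NM Mexp a a0; apply: le_lt_trans (Mexp a a0).
apply: le_integral_of_le => w; first by rewrite lee_fin expR_ge0.
by rewrite lee_fin ler_expR ler_pM2l.
Qed.

(** [exp (x + y) <= exp (2 x) + exp (2 y)]. *)
Lemma exp_momentsD N M : measurable_fun setT N -> measurable_fun setT M ->
  exp_moments N -> exp_moments M -> exp_moments (fun w => N w + M w)%R.
Proof.
move=> mN mM Nexp Mexp a a0; have a20 : (0 < 2 * a)%R by rewrite mulr_gt0.
have mexp (L : T -> R) b : measurable_fun setT L -> measurable_fun setT (fun w => (expR (b * L w))%:E).
  move=> mL; apply/measurable_EFinP; apply: measurableT_comp => //.
  exact: measurable_funM.
apply: (@le_lt_trans _ _ (\int[P]_w ((expR (2 * a * N w))%:E + (expR (2 * a * M w))%:E))).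
  apply: le_integral_of_le => w; first by rewrite lee_fin expR_ge0.
  rewrite -EFinD lee_fin; have [NM|/ltW MN] := leP (N w) (M w).
    by apply: ler_wpDl; [exact: expR_ge0|rewrite ler_expR; have := ler_wpM2l (ltW a0) NM; lra].
  by apply: ler_wpDr; [exact: expR_ge0|rewrite ler_expR; have := ler_wpM2l (ltW a0) MN; lra].
rewrite ge0_integralD//; [|exact: mexp..].
  by apply: lte_add_pinfty; [exact: (Nexp _ a20)|exact: (Mexp _ a20)].
Qed.

Lemma cnt_disk_le (Y : config R) : locally_finite Y ->
  (cnt `[(-1)%R, 1%R] Y <= cnt `[(- 2^-1)%R, 2^-1%R] Y +
    (cnt `[(- 2^-1 + 1)%R, (2^-1 + 1)%R] Y + cnt `[(- 2^-1 - 1)%R, (2^-1 - 1)%R] Y))%R.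
Proof.
move=> fY; rewrite !cntE// -!natrD ler_nat -!size_cat.
apply: uniq_leq_size => [|y]; first exact: fset_uniq.
rewrite !mem_cat !in_fset_set// !inE/= !in_itv/= => -[Yy /andP[y1 y2]].
have [h1|h1] := leP y (2^-1)%R; have [h2|h2] := leP (- 2^-1)%R y.
- by apply/orP; left; apply/mem_set; split => //=; rewrite in_itv/=; lra.
- apply/orP; right; apply/orP; right; apply/mem_set; split => //=; rewrite in_itv/=; lra.
- apply/orP; right; apply/orP; left; apply/mem_set; split => //=; rewrite in_itv/=; lra.
- by exfalso; lra.
Qed.

(** Three translates of [-1/2, 1/2] cover [-1, 1]. *)
Lemma stationary_exp_moments (Y : T -> config R) : simple_point_process Y ->
  stationary P Y -> exp_moments (fun w => cnt `[(- 2^-1)%R, 2^-1%R] (Y w)) ->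
  exp_moments (fun w => cnt `[(-1)%R, 1%R] (Y w)).
Proof.
move=> Ypp Ystat Yexp.
have mcnt (i : interval R) : measurable_fun setT (fun w => cnt [set` i] (Y w)).
  by apply: measurable_cnt_process => //; exact: measurable_itv.
have shift x : exp_moments (fun w => cnt `[(- 2^-1 + x)%R, (2^-1 + x)%R] (Y w)).
  by move=> a a0; rewrite stationary_exp_moment//; exact: (Yexp _ a0).
have sumexp : exp_moments (fun w => cnt `[(- 2^-1)%R, 2^-1%R] (Y w) +
    (cnt `[(- 2^-1 + 1)%R, (2^-1 + 1)%R] (Y w) +
     cnt `[(- 2^-1 - 1)%R, (2^-1 - 1)%R] (Y w)))%R.
  have s1 := shift 1%R; have s2 := shift (-1)%R.
  apply: exp_momentsD (mcnt _) _ Yexp _; first exact: measurable_funD.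
  exact: exp_momentsD (mcnt _) (mcnt _) s1 s2.
by apply: le_exp_moments sumexp => w; apply: cnt_disk_le; exact: Ypp.2.
Qed.

(** The counts in [-1/2, 1/2] are at most twice the length of the first layer in
    the disk. *)
Lemma first_layer_exp_moments (Yv Yh : T -> config R) :
  simple_point_process Yv -> simple_point_process Yh ->
  stationary P Yv -> stationary P Yh ->
  (forall a : R, \int[P]_w expeR (a%:E *
     hausdorff1 (manhattan (Yv w) (Yh w) `&` unit_disk)) < +oo) ->
  exp_moments (fun w => cnt `[(-1)%R, 1%R] (Yv w) + cnt `[(-1)%R, 1%R] (Yh w))%R.
Proof.
move=> vpp hpp vstat hstat Hexp.
have mcnt (i : interval R) Y : simple_point_process Y ->
    measurable_fun setT (fun w : T => cnt [set` i] (Y w)).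
  by move=> Ypp; apply: measurable_cnt_process => //; exact: measurable_itv.
suff dominated (N : T -> R) : (forall w,
    (N w)%:E <= 2%:E * hausdorff1 (manhattan (Yv w) (Yh w) `&` unit_disk)) ->
    exp_moments N.
  apply: exp_momentsD; [exact: mcnt|exact: mcnt|..].
  - apply: stationary_exp_moments => //; apply: dominated => w.
    exact: (cnt_le_hausdorff1_manhattan (vpp.2 w) (hpp.2 w)).1.
  - apply: stationary_exp_moments => //; apply: dominated => w.
    exact: (cnt_le_hausdorff1_manhattan (vpp.2 w) (hpp.2 w)).2.
move=> NH a a0; apply: le_lt_trans (Hexp (a * 2)%R).
apply: le_integral_of_le => w; first by rewrite lee_fin expR_ge0.
by rewrite -[leLHS]/(expeR (a * N w)%:E) lee_expeR !EFinM -muleA lee_pmul2l ?lte_fin.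
Qed.

End exponential_moments.
(** * Poisson edge lengths on a set of grid squares *)

Section poisson_lengths.
Context d (T : measurableType d) (R : realType) (P : probability T R).

(** The slope of a linear upper bound for [exp (a x) - 1] on [0, 3], the range
    of the total height of a column of squares. *)
Definition rate (a : R) : R := (a * expR (3 * a))%R.

Lemma rate_ge0 (a : R) : (0 < a)%R -> (0 <= rate a)%R.
Proof. by move=> a0; rewrite mulr_ge0 ?expR_ge0// ltW. Qed.

Lemma expR_sub1_le (a x : R) : (0 < a)%R -> (0 <= x <= 3)%R ->
  (expR (a * x) - 1 <= rate a * x)%R.
Proof.
move=> a0 /andP[x0 x3]; rewrite /rate.
have ax0 : (0 <= a * x)%R by rewrite mulr_ge0// ltW.
have e1 : (expR (a * x) - 1 <= a * x * expR (a * x))%R.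
  have := expR_ge1Dx (- (a * x)); rewrite -(ler_pM2r (expR_gt0 (a * x))).
  by rewrite expRN mulVf ?gt_eqF ?expR_gt0//; lra.
apply: le_trans e1 _; rewrite [leRHS]mulrAC; apply: ler_wpM2l => //.
by rewrite ler_expR [leRHS]mulrC ler_pM2l.
Qed.

Variables (Y : T -> config R) (lambda : R).
Hypotheses (Ypois : poisson_process P lambda Y) (lambda0 : (0 < lambda)%R).

Let Ypp : simple_point_process Y.
Proof. by case: Ypois. Qed.

Lemma poisson_cell_exp n k (b : R) :
  \int[P]_w (expR (b * cnt (gcell n k) (Y w)))%:E =
  (expR (lambda * mesh R n * (expR b - 1)))%:E.
Proof.
rewrite (poisson_exp_moment _ Ypois lambda0 (@measurable_gcell R n k)
  (a := node R n k) (b := node R n k.+1)) ?lebesgue_gcell//.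
by move=> t; rewrite /gcell/= !in_itv/= => /andP[-> /ltW ->].
Qed.

Lemma poisson_independent_cells n (c : nat -> R) (s : seq nat) : uniq s ->
  \int[P]_w (expR (\sum_(k <- s) c k * cnt (gcell n k) (Y w)))%:E =
  \prod_(k <- s) \int[P]_w (expR (c k * cnt (gcell n k) (Y w)))%:E.
Proof.
move=> us; have [_ _ /(_ (@gcell R n))] := Ypois.
move=> /(_ (@measurable_gcell R n) (@trivIset_gcell R n)) Yind.
pose N k w : \bar R := counting ((Y w : set R) `&` gcell n k).
have mN k : measurable_fun setT (N k).
  exact: measurableT_comp (measurable_counting_in (measurable_gcell n k)) Ypp.1.
rewrite -(@integral_mutually_independent _ _ _ _ _ _ _ N mN Yind
  (fun k x => (expR (c k * fine x))%:E))//.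
- by apply: eq_integral => w _; rewrite expR_sum prodEFin.
- move=> k; apply/measurable_EFinP; apply: measurableT_comp => //.
  by apply: measurable_funM => //; exact: fine_measurable.
- by move=> k; rewrite poisson_cell_exp ltry.
Qed.

(** The map [f] sends a square to its column or to its row.  A point in column
    [k] contributes [mesh n * c k <= 3] to the length, where [c k] is the number
    of squares of [V] in that column; the linear bound of [expR_sub1_le] then
    makes the exponent proportional to the area [mesh n ^+ 2 * #|V|]. *)
Lemma poisson_length_exp_le n (V : {set 'I_n.+1 * 'I_n.+1})
    (f : 'I_n.+1 * 'I_n.+1 -> 'I_n.+1) (a : R) : (0 < a)%R ->
  (forall k, #|[set kl in V | f kl == k]| <= n.+1)%N ->
  \int[P]_w (expR (a * (mesh R n * \sum_(kl in V) cnt (gcell n (f kl)) (Y w))))%:E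
  <= (expR (lambda * rate a * (mesh R n ^+ 2 * #|V|%:R)))%:E.
Proof.
move=> a0 Vf.
pose c (k : nat) : nat := #|[set kl in V | f kl == k :> nat]|.
have cn (k : nat) : (c k <= n.+1)%N.
  have [kn|nk] := ltnP k n.+1; first exact: (Vf (Ordinal kn)).
  rewrite /c eq_card0// => kl; rewrite !inE; apply/negbTE/nandP; right.
  by rewrite neq_ltn (leq_trans (ltn_ord (f kl)) nk).
have sumc (g : nat -> R) : (\sum_(kl in V) g (f kl) =
    \sum_(k <- iota 0 n.+1) (c k)%:R * g k)%R.
  rewrite -[iota _ _]/(index_iota 0 n.+1) big_mkord.
  rewrite (partition_big f xpredT)//=; apply: eq_bigr => k _.
  rewrite (eq_bigr (fun=> g k)); last by move=> kl /andP[_ /eqP ->].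
  rewrite sumr_const mulr_natl; congr (_ *+ _)%R.
  by apply: eq_card => kl; rewrite !inE.
rewrite [leLHS](_ : _ = \int[P]_w (expR (\sum_(k <- iota 0 n.+1)
    (a * (mesh R n * (c k)%:R)) * cnt (gcell n k) (Y w)))%:E); last first.
  apply: eq_integral => w _; congr (expR _)%:E.
  rewrite (sumc (fun k => cnt (gcell n k) (Y w))) !mulr_sumr.
  by apply: eq_bigr => k _; ring.
rewrite poisson_independent_cells ?iota_uniq//.
under eq_bigr do rewrite poisson_cell_exp.
rewrite prodEFin lee_fin -expR_sum ler_expR.
have -> : #|V|%:R = (\sum_(k <- iota 0 n.+1) (c k)%:R * 1 :> R)%R.
  by rewrite -(sumc (fun=> 1%R)) sumr_const.
rewrite !mulr_sumr; apply: ler_sum => k _.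
have h0 := mesh_gt0 R n.
have hc : (0 <= mesh R n * (c k)%:R <= 3)%R.
  apply/andP; split; first by apply: mulr_ge0 => //; exact: ltW.
  by rewrite -[leRHS](mesh_size R n) ler_pM2l// ler_nat cn.
have lh : (0 <= lambda * mesh R n)%R by apply: mulr_ge0; exact: ltW.
apply: le_trans (ler_wpM2l lh (expR_sub1_le a0 hc)) _.
by rewrite le_eqVlt; apply/orP; left; apply/eqP; ring.
Qed.

End poisson_lengths.
(** * Conditioning on the first layer *)

Section conditioning.
Context d (T : measurableType d) (R : realType) (P : probability T R).
Context d' (U : measurableType d') (layer : option nat -> T -> U).
Hypothesis mlayer : forall k, measurable_fun setT (layer k).
Hypothesis ind : mutually_independent P (fun k => sigma_of (layer k)).
Context (K : finType) (D : nat -> K -> set U).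
Hypothesis mD : forall i x, measurable (D i x).
Hypothesis D_disj : forall i j x w, D i x (layer None w) -> D j x (layer None w) -> i = j.
Context (g : U -> R) (psi : {set K} -> U -> R) (kappa : R).
Hypotheses (mg : measurable_fun setT g) (g0 : forall u, (0 <= g u)%R).
Hypothesis g_fin : \int[P]_w (g (layer None w))%:E < +oo.
Hypotheses (mpsi : forall V, measurable_fun setT (psi V))
  (psi0 : forall V u, (0 <= psi V u)%R) (kappa0 : (0 <= kappa)%R).
Hypothesis psi_le : forall i V,
  \int[P]_w (psi V (layer (Some i) w))%:E <= (expR (kappa * #|V|%:R))%:E.

(** Below, [layer None] is the first layer and [layer (Some i)] the tessellation
    nested in the [i]-th cell; [D i x] is the event that cell [i] contains the
    grid point [x], and [psi V] is the exponential weight of a second layer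
    observed on the squares [V]. *)
Definition selected i (u : U) : {set K} := [set x | `[< D i x u >]]%SET.

(* The first layer assigns the squares [V i] to cell [i], for all [i < n]. *)
Let event n (V : {ffun 'I_n -> {set K}}) : set U :=
  [set u | forall i : 'I_n, selected i u = V i].

Let measurable_event n (V : {ffun 'I_n -> {set K}}) : measurable (event V).
Proof.
have -> : event V = \bigcap_(i in [set: 'I_n]) \bigcap_(x in [set: K])
    (if x \in V i then D i x else ~` D i x).
  apply/seteqP; split => u.
    move=> uV i _ x _; rewrite -uV inE; case: asboolP => //.
  move=> uV i; apply/setP => x; have := uV i I x I; rewrite inE.
  by case: (x \in V i) => ?; apply/asboolP.
apply: fin_bigcap_measurable => // i _; apply: fin_bigcap_measurable => // x _.
by case: ifP => _ //; exact: measurableC.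
Qed.

Let extend n (V : {ffun 'I_n -> {set K}}) (i : nat) : {set K} :=
  oapp V (finset.set0 : {set K}) (insub i).

Let extendE n (V : {ffun 'I_n -> {set K}}) (i : 'I_n) : extend V i = V i.
Proof. by rewrite /extend valK. Qed.

Let factor n (V : {ffun 'I_n -> {set K}}) (k : option nat) (u : U) : \bar R :=
  if k is Some i then (psi (extend V i) u)%:E else (g u * \1_(event V) u)%:E.

Let labels n : seq (option nat) := None :: [seq Some (val i) | i <- enum 'I_n].

Let prod_labels n (F : option nat -> \bar R) :
  \prod_(k <- labels n) F k = F None * \prod_(i < n) F (Some (val i)).
Proof. by rewrite big_cons big_map big_enum. Qed.

Let mfactor n (V : {ffun 'I_n -> {set K}}) k : measurable_fun setT (factor V k).
Proof.
case: k => [i|]; apply/measurable_EFinP => //.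
by apply: measurable_funM => //; exact: measurable_indic.
Qed.

Let factor_ge0 n (V : {ffun 'I_n -> {set K}}) k u : 0 <= factor V k u.
Proof. by case: k => [i|]; rewrite lee_fin// mulr_ge0. Qed.

Let factor_fin n (V : {ffun 'I_n -> {set K}}) k :
  \int[P]_w factor V k (layer k w) < +oo.
Proof.
case: k => [i|]; first exact: le_lt_trans (psi_le _ _) (ltry _).
apply: le_lt_trans g_fin; apply: le_integral_of_le => w; first exact: (factor_ge0 V None).
by rewrite lee_fin ler_piMr// indicE lern1 leq_b1.
Qed.

Let sum_event n (a : \bar R) u :
  \sum_(V : {ffun 'I_n -> {set K}}) (\1_(event V) u : R)%:E * a = a.
Proof.
pose V0 : {ffun 'I_n -> {set K}} := [ffun i : 'I_n => selected i u].
rewrite (bigD1 V0)//= big1 ?adde0; last first.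
  move=> V /eqP VV0; rewrite indicE memNset ?mul0e// => uV; apply: VV0.
  by apply/ffunP => i; rewrite ffunE uV.
by rewrite indicE mem_set ?mul1e// => i; rewrite ffunE.
Qed.

(* The selected sets are pairwise disjoint, so their cardinals sum to at most
   [#|K|]. *)
Let prod_psi_le n (V : {ffun 'I_n -> {set K}}) w : event V (layer None w) ->
  \prod_(i < n) \int[P]_w (psi (V i) (layer (Some (val i)) w))%:E <=
  (expR (kappa * #|K|%:R))%:E.
Proof.
move=> wV.
apply: (@le_trans _ _ (\prod_(i < n) (expR (kappa * #|V i|%:R))%:E)).
  suff [] : 0 <= \prod_(i < n) \int[P]_w (psi (V i) (layer (Some (val i)) w))%:E /\
      \prod_(i < n) \int[P]_w (psi (V i) (layer (Some (val i)) w))%:E <=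
      \prod_(i < n) (expR (kappa * #|V i|%:R))%:E by [].
  elim/big_ind2: _ => [|x y x' y' [x0 xy] [x0' xy']|i _].
  - by split; rewrite ?lee01.
  - by split; [exact: mule_ge0|exact: lee_pmul].
  - by split; [apply: integral_ge0 => u _; rewrite lee_fin|exact: psi_le].
rewrite prodEFin lee_fin -expR_sum ler_expR -mulr_sumr ler_wpM2l// -natr_sum ler_nat.
have disj i j : i != j -> fintype.disjoint (mem (V i)) (mem (V j)).
  move=> ij; rewrite -finset.setI_eq0; apply/eqP/setP => x; rewrite !inE -!wV !inE.
  apply/negbTE/negP => /andP[/asboolP Di /asboolP Dj].
  by move/eqP: ij; apply; apply/val_inj; exact: D_disj Di Dj.
under eq_bigr do rewrite -sum1_card.
by rewrite -partition_disjoint_bigcup// sum1_card max_card.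
Qed.

Let integrand n w : R := g (layer None w) *
  \prod_(i < n) psi (selected i (layer None w)) (layer (Some (val i)) w).

Let integrandE n w : (integrand n w)%:E =
  \sum_(V : {ffun 'I_n -> {set K}}) \prod_(k <- labels n) factor V k (layer k w).
Proof.
rewrite -[LHS](sum_event n _ (layer None w)); apply: eq_bigr => V _.
rewrite prod_labels /= /integrand !EFinM -prodEFin muleCA !muleA.
have [/set_mem wV|nwV] := boolP (layer None w \in event V); last first.
  by rewrite indicE (negbTE nwV) !(mule0, mul0e).
by congr (_ * _); apply: eq_bigr => i _; rewrite extendE wV.
Qed.

Let measurable_prod_factor n (V : {ffun 'I_n -> {set K}}) : measurable_fun setT
  (fun w => \prod_(k <- labels n) factor V k (layer k w)).
Proof.
elim: (labels n) => [|k s IH].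
  by under eq_fun do rewrite big_nil; exact: measurable_cst.
under eq_fun do rewrite big_cons; apply: emeasurable_funM => //.
exact: measurableT_comp.
Qed.

Lemma measurable_conditional_product n : measurable_fun setT (fun w =>
  (g (layer None w) *
   \prod_(i < n) psi (selected i (layer None w)) (layer (Some (val i)) w))%:E).
Proof.
rewrite (_ : (fun w => _) = (fun w => \sum_(V : {ffun 'I_n -> {set K}})
    \prod_(k <- labels n) factor V k (layer k w))).
  by apply: emeasurable_sum => V; exact: measurable_prod_factor.
by apply/funext => w; rewrite -integrandE.
Qed.

(** The expectation is split over the finitely many values of the selected sets.
    On each of them the weights are functions of independent layers, and their
    expectations multiply to at most [exp (kappa #|K|)], whatever the value. *)
Lemma conditional_product_le n :
  \int[P]_w (g (layer None w) *
    \prod_(i < n) psi (selected i (layer None w)) (layer (Some (val i)) w))%:E <=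
  (expR (kappa * #|K|%:R))%:E * \int[P]_w (g (layer None w))%:E.
Proof.
have uniq_labels : uniq (labels n).
  rewrite /labels /= map_inj_uniq ?enum_uniq ?andbT//; last first.
    by move=> i j [/val_inj].
  by apply/negP => /mapP[].
have mfirst V : measurable_fun setT (fun w => factor V None (layer None w)).
  by apply: measurableT_comp (mfactor _ _) (mlayer _).
rewrite [leLHS](_ : _ = \int[P]_w (\sum_(V : {ffun 'I_n -> {set K}})
    \prod_(k <- labels n) factor V k (layer k w))); last first.
  by apply: eq_integral => w _; rewrite -integrandE.
rewrite ge0_integral_sum//; last by move=> V w _; apply: prode_ge0.
rewrite [in leRHS](_ : \int[P]_w (g (layer None w))%:E =
    \sum_(V : {ffun 'I_n -> {set K}}) \int[P]_w factor V None (layer None w)); last first.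
  rewrite -ge0_integral_sum//.
  apply: eq_integral => w _; rewrite -[LHS](sum_event n _ (layer None w)).
  by apply: eq_bigr => V _; rewrite /= EFinM muleC.
rewrite ge0_sume_distrr; last by move=> V _; apply: integral_ge0 => w _; exact: (factor_ge0 V None).
apply: lee_sum => V _.
rewrite (integral_mutually_independent mlayer ind (@mfactor _ V) (@factor_ge0 _ V)
  (@factor_fin _ V) uniq_labels) prod_labels muleC.
have [[w wV]|noV] := pselect (exists w, event V (layer None w)).
  apply: lee_wpmul2r; first by apply: integral_ge0 => u _; exact: (factor_ge0 V None).
  by under eq_bigr do rewrite /= extendE; exact: prod_psi_le wV.
rewrite (_ : \int[P]_w factor V None (layer None w) = 0) ?mule0//.
rewrite integral0_eq// => w _; rewrite /= indicE memNset ?mulr0// => wV.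
by apply: noV; exists w.
Qed.

End conditioning.
(** * Exponential moments of the nested tessellation *)

Section second_layer.
Context (R : realType).

Lemma measurable_vlength n (V : {set 'I_n.+1 * 'I_n.+1}) :
  measurable_fun setT (@vlength R n V).
Proof.
apply: measurable_funM => //.
rewrite (_ : (fun Y : config R => _) =
    (fun Y => \sum_(kl <- enum V) cnt (gcell n kl.1) Y)%R).
  by apply: measurable_sum => kl; apply: measurable_cnt; exact: measurable_gcell.
by apply/funext => Y; rewrite big_enum.
Qed.

Lemma measurable_hlength n (V : {set 'I_n.+1 * 'I_n.+1}) :
  measurable_fun setT (@hlength R n V).
Proof.
apply: measurable_funM => //.
rewrite (_ : (fun Y : config R => _) =
    (fun Y => \sum_(kl <- enum V) cnt (gcell n kl.2) Y)%R).
  by apply: measurable_sum => kl; apply: measurable_cnt; exact: measurable_gcell.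
by apply/funext => Y; rewrite big_enum.
Qed.

(** A row or a column contains at most [n.+1] squares of [V], so
    [poisson_length_exp_le] applies to both families of lines. *)
Lemma second_layer_exp_le d (T : measurableType d) (P : probability T R)
    (Yv Yh : T -> config R) (lv lh a : R) n (V : {set 'I_n.+1 * 'I_n.+1}) :
  poisson_process P lv Yv -> poisson_process P lh Yh ->
  independent2 P (sigma_of Yv) (sigma_of Yh) ->
  (0 < lv)%R -> (0 < lh)%R -> (0 < a)%R ->
  \int[P]_w (expR (a * (vlength V (Yv w) + hlength V (Yh w))))%:E <=
  (expR ((lv + lh) * rate a * mesh R n ^+ 2 * #|V|%:R))%:E.
Proof.
move=> Yvp Yhp Yvh lv0 lh0 a0.
have [[mYv _] _ _] := Yvp; have [[mYh _] _ _] := Yhp.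
have mexp (f : config R -> R) : measurable_fun setT f ->
    measurable_fun setT (fun Y => (expR (a * f Y))%:E).
  by move=> mf; apply/measurable_EFinP; apply: measurableT_comp => //; exact: measurable_funM.
have vle := @poisson_length_exp_le _ _ _ _ _ _ Yvp lv0 n V fst a a0.
have hle := @poisson_length_exp_le _ _ _ _ _ _ Yhp lh0 n V snd a a0.
have {}vle : \int[P]_w (expR (a * vlength V (Yv w)))%:E <=
    (expR (lv * rate a * (mesh R n ^+ 2 * #|V|%:R)))%:E.
  apply: vle => k.
  apply: (@leq_trans #|finset.setX [set k]%SET [set: 'I_n.+1]%SET|); last first.
    by rewrite cardsX cards1 cardsT card_ord mul1n.
  by apply: subset_leq_card; apply/fintype.subsetP => kl; rewrite !inE andbT => /andP[].
have {}hle : \int[P]_w (expR (a * hlength V (Yh w)))%:E <=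
    (expR (lh * rate a * (mesh R n ^+ 2 * #|V|%:R)))%:E.
  apply: hle => k.
  apply: (@leq_trans #|finset.setX [set: 'I_n.+1]%SET [set k]%SET|); last first.
    by rewrite cardsX cards1 cardsT card_ord muln1.
  by apply: subset_leq_card; apply/fintype.subsetP => kl; rewrite !inE => /andP[].
rewrite [leLHS](_ : _ = \int[P]_w ((expR (a * vlength V (Yv w)))%:E *
    (expR (a * hlength V (Yh w)))%:E)); last first.
  by apply: eq_integral => w _; rewrite mulrDr expRD EFinM.
rewrite (@integral_independent2 _ _ _ _ _ _ _ Yv Yh
  (fun Y => (expR (a * vlength V Y))%:E) (fun Y => (expR (a * hlength V Y))%:E))//.
- rewrite (_ : (lv + lh) * _ * _ * _ = lv * rate a * (mesh R n ^+ 2 * #|V|%:R) +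
    lh * rate a * (mesh R n ^+ 2 * #|V|%:R))%R; last by ring.
  by rewrite expRD EFinM; apply: lee_pmul => //; apply: integral_ge0 => w _; rewrite lee_fin expR_ge0.
- exact: mexp (measurable_vlength V).
- exact: mexp (measurable_hlength V).
- exact: le_lt_trans hle (ltry _).
Qed.

End second_layer.

Theorem proposition1p4 (R : realType) (d : measure_display)
  (Omega : measurableType d) (P : probability Omega R)
  (Yov Yoh : Omega -> config R)
  (Yov_pp : simple_point_process Yov) (Yoh_pp : simple_point_process Yoh)
  (Yov_stat : stationary P Yov) (Yoh_stat : stationary P Yoh)
  (Yo_indep : independent2 P (sigma_of Yov) (sigma_of Yoh))
  (* the numbering of the cells depends on the first layer only *)
  (J : Omega -> set nat) (C : nat -> Omega -> set (R * R))
  (C_cells : forall w,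
     cell_labelling (manhattan (Yov w) (Yoh w)) (J w) (fun i => C i w))
  (C_meas : forall (i : nat) (x : R * R),
     sigma_of (fun w => (Yov w, Yoh w)) [set w | J w i /\ C i w x])
  (lambda_v lambda_h : R)
  (lambda_v_gt0 : (0 < lambda_v)%R) (lambda_h_gt0 : (0 < lambda_h)%R)
  (Yv Yh : nat -> Omega -> config R)
  (Yv_poisson : forall i, poisson_process P lambda_v (Yv i))
  (Yh_poisson : forall i, poisson_process P lambda_h (Yh i))
  (Y_indep : forall i, independent2 P (sigma_of (Yv i)) (sigma_of (Yh i)))
  (layers_indep : mutually_independent P (fun k : option nat =>
     if k is Some i then sigma_of (fun w => (Yv i w, Yh i w))
     else sigma_of (fun w => (Yov w, Yoh w))))
  (So_exp_moments : forall alpha : R,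
     \int[P]_w expeR (alpha%:E *
       hausdorff1 (manhattan (Yov w) (Yoh w) `&` unit_disk)) < +oo) :
  forall alpha : R,
    \int[P]_w expeR (alpha%:E *
      hausdorff1 (nested (manhattan (Yov w) (Yoh w)) (J w) (fun i => C i w)
                    (fun i => manhattan (Yv i w) (Yh i w))
                  `&` unit_disk)) < +oo.
Proof.
move=> alpha.
(* The integrand is at most [1] for [alpha <= 0]. *)
have [alpha_le0|alpha0] := leP alpha 0%R.
  apply: (@le_lt_trans _ _ (\int[P]_w (cst 1 w))).
    apply: le_integral_of_le => w; first exact: expeR_ge0.
    rewrite -[leRHS]expeR0 lee_expeR mule_le0_ge0 ?lee_fin//.
    exact: outer_measure_ge0.
  by rewrite integral_cst// mul1e (le_lt_trans (probability_le1 _ _))// ltry.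
pose X w : config R * config R := (Yov w, Yoh w).
pose layer (k : option nat) w : config R * config R :=
  if k is Some i then (Yv i w, Yh i w) else X w.
have mlayer k : measurable_fun setT (layer k).
  case: k => [i|]; apply: measurable_fun_pair.
  - by have [[]] := Yv_poisson i.
  - by have [[]] := Yh_poisson i.
  - exact: Yov_pp.1.
  - exact: Yoh_pp.1.
have layer_ind : mutually_independent P (fun k => sigma_of (layer k)).
  rewrite (_ : (fun k => _) = (fun k : option nat =>
     if k is Some i then sigma_of (fun w => (Yv i w, Yh i w))
     else sigma_of (fun w => (Yov w, Yoh w))))//.
  by apply/funext => -[].
have /choice[D0 D0P] : forall ix : nat * (R * R), exists B : set (config R * config R),
    measurable B /\ X @^-1` B = [set w | J w ix.1 /\ C ix.1 w ix.2].
  by move=> [i x]; have [B mB BE] := C_meas i x; exists B; rewrite setTI in BE.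
pose D n i (kl : 'I_n.+1 * 'I_n.+1) := D0 (i, (node R n kl.1, node R n kl.2)).
have DE n i kl w : D n i kl (X w) <-> J w i /\ C i w (node R n kl.1, node R n kl.2).
  have [_ BE] := D0P (i, (node R n kl.1, node R n kl.2)).
  have -> : D n i kl (X w) = (X @^-1` D n i kl) w by [].
  by rewrite BE.
have mD n i kl : measurable (D n i kl) by have [] := D0P (i, (node R n kl.1, node R n kl.2)).
have D_disj n i j kl w : D n i kl (X w) -> D n j kl (X w) -> i = j.
  move=> /DE[Ji Ci] /DE[Jj Cj]; have [cells inj _] := C_cells w.
  apply: inj; rewrite ?inE//.
  exact: cell_eq (cells _ Ji) (cells _ Jj) Ci Cj.
pose cnts (y : config R * config R) : R :=
  (cnt `[(-1)%R, 1%R] y.1 + cnt `[(-1)%R, 1%R] y.2)%R.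
pose g y := expR (alpha * (2 * cnts y)).
have mcnts : measurable_fun setT cnts.
  by apply: measurable_funD; apply: measurableT_comp => //; exact: measurable_cnt.
have mg : measurable_fun setT g.
  apply: measurableT_comp => //; apply: measurable_funM => //; exact: measurable_funM.
have gfin : \int[P]_w (g (X w))%:E < +oo.
  have := first_layer_exp_moments Yov_pp Yoh_pp Yov_stat Yoh_stat So_exp_moments.
  by move=> /(_ (alpha * 2)%R); rewrite mulr_gt0// => /(_ isT);
    under eq_integral do rewrite -mulrA.
pose psi n V (y : config R * config R) := expR (alpha * (@vlength R n V y.1 + @hlength R n V y.2)).
have mpsi n V : measurable_fun setT (@psi n V).
  apply: measurableT_comp => //; apply: measurable_funM => //.
  apply: measurable_funD; apply: measurableT_comp => //.
    exact: measurable_vlength.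
  exact: measurable_hlength.
pose kappa n := ((lambda_v + lambda_h) * rate alpha * mesh R n ^+ 2)%R.
have kappa0 n : (0 <= kappa n)%R.
  apply: mulr_ge0; last exact: sqr_ge0.
  by apply: mulr_ge0; [lra|exact: rate_ge0].
have psi_le n i V : \int[P]_w (psi n V (layer (Some i) w))%:E <=
    (expR (kappa n * #|V|%:R))%:E.
  exact: (second_layer_exp_le V (Yv_poisson i) (Yh_poisson i) (Y_indep i)
    lambda_v_gt0 lambda_h_gt0 alpha0).
pose sel n i w := nodes_in n [set x | J w i /\ C i w x].
have selE n i w : selected (D n) i (X w) = sel n i w.
  by apply/setP => kl; rewrite !inE; apply/asboolP/asboolP => /DE.
pose F n w := (g (X w) *
  \prod_(i < n) psi n (selected (D n) i (X w)) (layer (Some (val i)) w))%R.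
have mF n : measurable_fun setT (fun w => (F n w)%:E).
  exact: (@measurable_conditional_product _ _ _ _ _ layer mlayer _ (D n) (mD n) g
    (psi n) mg (@mpsi n)).
have F0 n w : setT w -> 0 <= (F n w)%:E.
  move=> _; rewrite lee_fin mulr_ge0 ?expR_ge0// prodr_ge0// => i _; exact: expR_ge0.
(* [9] is the area of the box, so [kappa n] times the number of squares does not
   depend on [n]. *)
pose K := ((lambda_v + lambda_h) * rate alpha * 9)%R.
have F_le n : \int[P]_w (F n w)%:E <= (expR K)%:E * \int[P]_w (g (X w))%:E.
  have := @conditional_product_le _ _ _ P _ _ layer mlayer layer_ind _ (D n)
    (mD n) (@D_disj n) g (psi n) (kappa n) mg (fun u => expR_ge0 _) gfin (@mpsi n)
    (fun V u => expR_ge0 _) (kappa0 n) (psi_le n) n.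
  rewrite card_prod card_ord natrM (_ : kappa n * _ = K)%R//.
  rewrite /kappa /K -mulrA; congr (_ * _)%R.
  rewrite expr2 mulrACA mesh_size; ring.
apply: (@le_lt_trans _ _ (\int[P]_w limn_einf (fun n => (F n w)%:E))).
  apply: le_integral_of_le => w; first exact: expeR_ge0.
  rewrite (_ : (fun n => _) = (fun n => expeR (alpha%:E *
      (2 * cnts (X w) + \sum_(i < n) (vlength (sel n i w) (Yv i w) +
        hlength (sel n i w) (Yh i w)))%:E))).
    apply: le_trans (expeR_limn_einf _ alpha0).
    rewrite lee_expeR lee_pmul2l ?lte_fin//.
    apply: hausdorff1_nested_le.
    - exact: Yov_pp.2.
    - exact: Yoh_pp.2.
    - by move=> i; have [[_ lf] _ _] := Yv_poisson i; exact: lf.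
    - by move=> i; have [[_ lf] _ _] := Yh_poisson i; exact: lf.
    - by move=> i Ji; have [cells _ _] := C_cells w; have [] := cells _ Ji.
  apply/funext => n; rewrite -EFinM /= /F /g; congr _%:E.
  rewrite [in RHS]mulrDr [in RHS]expRD [in RHS]mulr_sumr [in RHS]expR_sum; congr (_ * _)%R.
  by apply: eq_bigr => i _; rewrite selE.
apply: le_lt_trans (fatou P measurableT mF F0) _.
apply: le_lt_trans (limn_einf_le F_le) _.
by apply: lte_mul_pinfty; rewrite ?lee_fin ?expR_ge0.
Qed.
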